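(* Let $\sigma:\Gamma\to B$ be a strong formal subdivision of rank $r-n$ between a lower Eulerian poset $\Gamma$ of rank $r$ and an Eulerian poset $B$ of rank $n$. Then: (1) $h_B(\Gamma;u,v)=h_B(\Gamma;v,u)$. (2) $h_B(\Gamma;u,1)=h(\Gamma;u)$. (3) $(uv)^rh_B(\Gamma;u^{-1},v^{-1})=\sum_{x\in B}h_B(\Gamma,x,\hat0_\Gamma;u,v)(uv-1)^{\rho_B(x,\hat1_B)}$. (4) $h_B(\Gamma;0,v)=v^{r-n}$. (5) If $\Gamma=B$ and $\sigma$ is the identity, then $h_B(B;u,v)=g(B;uv)$. (6) If $n=0$, then $h_B(\Gamma;u,v)=v^rl_B(\Gamma;uv^{-1})=v^rh(\Gamma;uv^{-1})$. (7) All terms of $h_B(\Gamma;u,v)$ have combined degree in $u,v$ at most $r$, and the terms of combined degree $r$ sum to $v^rl_B(\Gamma;uv^{-1})$. (8) $v^rl_B(\Gamma;uv^{-1})=\sum_{x\in B}h_B(\Gamma,x,\hat0_\Gamma;u,v)(-1)^{\rho_B(x,\hat1_B)}g([x,\hat1_B]^*;uv)$. (9) If $\tau:\Omega\to\Gamma$ and $\sigma:\Gamma\to B$ are strong formal subdivisions of locally Eulerian posets, then (with $h_B(\Omega,\cdot)$ computed with respect to $\sigma\circ\tau$) for all $z\in\Omega$, $x\in B$: $h_B(\Omega,x,z;u,v)=\sum_{y\in\Gamma}h_B(\Gamma,x,y;u,v)v^{\rho_\Gamma(y)-\rho_\Omega(z)}l_\Gamma(\Omega,y,z;uv^{-1})$;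 in particular if $\Omega,\Gamma$ are lower Eulerian and $B$ is Eulerian, $h_B(\Omega;u,v)=\sum_{y\in\Gamma}h_B(\Gamma,\hat1_B,y;u,v)v^{\operatorname{rk}(\Omega_y)}l_\Gamma(\Omega,y,\hat0_\Omega;uv^{-1})$.
   Context: All posets are finite. Locally graded: in every interval $[x,x']$ all maximal chains have the same length $\rho(x,x')$; $\operatorname{rk}$ = maximal chain length. Rank function $\rho_B:B\to\mathbb{Z}$ with $\rho(x,x')=\rho_B(x')-\rho_B(x)$. Eulerian: min $\hat0$, max $\hat1$, every interval of positive length has as many elements of even as of odd rank; locally Eulerian: every interval Eulerian; lower Eulerian: locally Eulerian with a minimum. $B^*$: reversed order. $g(B;t)$ for Eulerian $B$ of rank $n$: $1$ if $n=0$; else the unique polynomial of degree $<n/2$ with $t^ng(B;t^{-1})=\sum_{x}g([\hat0,x];t)(t-1)^{n-\rho(\hat0,x)}$. $h(B;t)$ for lower Eulerian $B$ of rank $n$: $t^nh(B;t^{-1})=\sum_xg([\hat0,x];t)(t-1)^{n-\rho(\hat0,x)}$. Strong formal subdivision: $\sigma:\Gamma\to B$ order-preserving with $\rho_\Gamma(y)\le\rho_B(\sigma(y))$, surjective, such that for all $y\in\Gamma,x\in B$ with $\sigma(y)\le x$ there is $y'\ge y$ with $\sigma(y')=x$, $\rho_\Gamma(y')=\rho_B(x)$, and $\sum_{y'\ge y,\sigma(y')=x}(-1)^{\rho_B(x)-\rho_\Gamma(y')}=1$. Its rank (for lower Eulerian $\Gamma,B$) is $\rho_B(\hat0_B)-\rho_\Gamma(\hat0_\Gamma)$.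 Write $(\Gamma_{\ge y})_x=\{y'\ge y:\sigma(y')\le x\}$ and $\Gamma_x=\{y':\sigma(y')\le x\}$. Local $h$: $l_B(\Gamma,x,y;t)=\sum_{\sigma(y)\le x'\le x}h((\Gamma_{\ge y})_{x'};t)(-1)^{\rho_B(x',x)}g([x',x]^*;t)$ if $\sigma(y)\le x$, and $0$ otherwise; for $\Gamma$ lower Eulerian and $B$ Eulerian, $l_B(\Gamma;t)=l_B(\Gamma,\hat1_B,\hat0_\Gamma;t)$. Mixed $h$: $h_B(\Gamma,x,y;u,v)=\sum_{\sigma(y)\le x'\le x}v^{\rho_B(x')-\rho_\Gamma(y)}l_B(\Gamma,x',y;uv^{-1})g([x',x];uv)$ if $\sigma(y)\le x$, and $0$ otherwise; $h_B(\Gamma;u,v)=h_B(\Gamma,\hat1_B,\hat0_\Gamma;u,v)$. *)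

(* Defs.v *)
From mathcomp Require Import all_boot all_order all_algebra.
From mathcomp Require Import boolp classical_sets.

Set Implicit Arguments.
Unset Strict Implicit.
Unset Printing Implicit Defensive.

Import Order.TTheory GRing.Theory Num.Theory.
Local Open Scope ring_scope.

(** Finite posets are [finPOrderType]s; a subset [A : {set T}] stands for the
    induced subposet, so that intervals, ideals and fibers are posets of the
    same kind as the whole poset [[set: T]]. *)
Section Posets.
Context {d : Order.disp_t} {T : finPOrderType d}.
Implicit Types (A C : {set T}) (x y : T).

Definition is_chain C : bool := [forall x in C, forall y in C, (x >=< y)%O].

Definition chain_in A C : bool := (C \subset A) && is_chain C.

Definition rk A : nat := (\max_(C : {set T} | chain_in A C) #|C|.-1)%N.

Definition itv_in A x y : {set T} := [set z in A | (x <= z)%O && (z <= y)%O].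

Definition itv x y : {set T} := itv_in [set: T] x y.

Definition rho_in A x y : nat := rk (itv_in A x y).

Definition rho x y : nat := rho_in [set: T] x y.

Definition locally_graded A : Prop :=
  forall x y, x \in A -> y \in A -> (x <= y)%O ->
  forall C, maxset (chain_in (itv_in A x y)) C -> #|C|.-1 = rho_in A x y.

Definition is_rank_function (r : T -> int) : Prop :=
  forall x y, (x <= y)%O -> (rho x y)%:Z = r y - r x.

Definition is_minimum A x : Prop := x \in A /\ forall z, z \in A -> (x <= z)%O.

Definition is_maximum A x : Prop := x \in A /\ forall z, z \in A -> (z <= x)%O.

Definition Eulerian A : Prop :=
  [/\ locally_graded A, exists x, is_minimum A x, exists x, is_maximum A x &
      forall x y, x \in A -> y \in A -> (x <= y)%O -> (0 < rho_in A x y)%N ->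
        #|[set z in itv_in A x y | ~~ odd (rho_in A x z)]| =
        #|[set z in itv_in A x y | odd (rho_in A x z)]| ].

Definition locally_Eulerian A : Prop :=
  forall x y, x \in A -> y \in A -> (x <= y)%O -> Eulerian (itv_in A x y).

Definition lower_Eulerian A : Prop :=
  locally_Eulerian A /\ exists x, is_minimum A x.

(** The interval from the minimum of [A] to [x], when [A] has a minimum. *)
Definition down A x : {set T} := [set z in A | (z <= x)%O].

Definition dual_set A : {set T^d} := [set z : T^d | (z : T) \in A].

End Posets.

Definition eval1 {S : comNzRingType} (p : {poly int}) (a : S) : S :=
  (map_poly intr p).[a].

(** [t^n p(t^-1)], for [p] of degree at most [n]; see [revpE]. *)
Definition revp (n : nat) (p : {poly int}) : {poly int} :=
  \poly_(i < n.+1) p`_(n - i).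

Lemma eval1_wide (S : comNzRingType) (p : {poly int}) (a : S) (n : nat) :
  (size p <= n)%N -> eval1 p a = \sum_(i < n) (p`_i)%:~R * a ^+ i.
Proof.
move=> sp; rewrite /eval1 (horner_coef_wide _ (leq_trans (size_poly _ _) sp)).
by apply: eq_bigr => i _; rewrite coef_map.
Qed.

Lemma revpE (F : fieldType) (n : nat) (p : {poly int}) (a : F) :
  (size p <= n.+1)%N -> a != 0 ->
  eval1 (revp n p) a = a ^+ n * eval1 p a^-1.
Proof.
move=> sp a0; rewrite (eval1_wide _ (size_poly _ _)) (eval1_wide _ sp) mulr_sumr.
rewrite (reindex_inj rev_ord_inj) /=; apply: eq_bigr => i _.
have lein : (i <= n)%N by rewrite -ltnS.
rewrite coef_poly subSS ltnS leq_subr subKn // mulrCA.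
by congr (_ * _); rewrite exprVn -expfB_cond // (negbTE a0).
Qed.

Section GHPolynomials.
Context {d : Order.disp_t} {T : finPOrderType d}.
Implicit Types (A : {set T}).

(** [\sum_(x in A) g([0,x];t) (t-1)^(n - rho(0,x))] with [n = rk A]. *)
Definition gsum (g : {set T} -> {poly int}) A : {poly int} :=
  \sum_(x in A) g (down A x) * ('X - 1) ^+ (rk A - rk (down A x)).

Definition is_gpoly (g : {ffun {set T} -> {poly int}}) : Prop :=
  forall A, Eulerian A ->
    (rk A = 0%N -> g A = 1) /\
    ((0 < rk A)%N ->
       ((size (g A)).-1.*2 < rk A)%N /\ revp (rk A) (g A) = gsum g A).

(** [is_gpoly] determines the values at all Eulerian [A]; the other values are
    never used. *)
Definition gpoly A : {poly int} := xget [ffun=> 0] is_gpoly A.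

(** The relation [t^n h(t^-1) = gsum] solved for [h]. *)
Definition hpoly A : {poly int} := revp (rk A) (gsum gpoly A).

End GHPolynomials.

(** Polynomials in two variables are [{poly {poly int}}], with [u] the outer and
    [v] the inner variable: [p`_i`_j] is the coefficient of [u^i v^j]. *)
Definition varu : {poly {poly int}} := 'X.
Definition varv : {poly {poly int}} := 'X%:P.

Definition eval2 {S : comNzRingType} (p : {poly {poly int}}) (a b : S) : S :=
  (map_poly (fun c => eval1 c b) p).[a].

(** [v^m p(u v^-1)], for [p] of degree at most [m]; see [homogE]. *)
Definition homog (m : nat) (p : {poly int}) : {poly {poly int}} :=
  \sum_(i < m.+1) (p`_i)%:~R * varu ^+ i * varv ^+ (m - i).

Lemma homogE (F : fieldType) (m : nat) (p : {poly int}) (u v : F) :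
  (size p <= m.+1)%N -> v != 0 ->
  eval2 (homog m p) u v = v ^+ m * eval1 p (u / v).
Proof.
move=> sp v0; rewrite (eval1_wide _ sp) mulr_sumr /eval2.
rewrite -[map_poly _ _]/(map_poly (horner_eval v \o map_poly intr) _).
rewrite rmorph_sum horner_sum; apply: eq_bigr => i _ /=.
have lein : (i <= m)%N by rewrite -ltnS.
have mX : map_poly (horner_eval v \o map_poly intr) varu = 'X by apply: map_polyX.
have mY : map_poly (horner_eval v \o map_poly intr) varv = v%:P.
  rewrite /varv map_polyC /=; congr (_%:P).
  by rewrite /horner_eval map_polyX hornerX.
rewrite !rmorphM !rmorphXn rmorph_int /= mX mY -!polyC_exp !hornerM hornerXn.
have -> : (p`_i)%:~R = ((p`_i)%:~R)%:P :> {poly F} by rewrite rmorph_int.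
rewrite !hornerC expr_div_n; have vi : v ^+ i != 0 by apply: expf_neq0.
have -> : v ^+ m = v ^+ (m - i) * v ^+ i by rewrite -exprD subnK.
rewrite mulrCA -!mulrA; congr (_ * _).
by rewrite [v ^+ i * _]mulrC divfK // mulrC.
Qed.

Section Subdivisions.
Context {dG dB : Order.disp_t} {G : finPOrderType dG} {B : finPOrderType dB}.
Variables (rG : G -> int) (rB : B -> int) (sigma : G -> B).

Definition strong_formal_subdivision : Prop :=
  [/\ {homo sigma : y y' / (y <= y')%O},
      forall y, rG y <= rB (sigma y),
      forall x, exists y, sigma y = x,
      forall y x, (sigma y <= x)%O ->
        exists y', [/\ (y <= y')%O, sigma y' = x & rG y' = rB x] &
      forall y x, (sigma y <= x)%O ->
        \sum_(y' | (y <= y')%O && (sigma y' == x))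
           (-1 : int) ^ (rB x - rG y') = 1].

(** The poset [(G_{>= y})_x]. *)
Definition fiber_above (y : G) (x : B) : {set G} :=
  [set y' | (y <= y')%O && (sigma y' <= x)%O].

(** The poset [G_x]. *)
Definition fiber (x : B) : {set G} := [set y' | (sigma y' <= x)%O].

Definition local_h (x : B) (y : G) : {poly int} :=
  if (sigma y <= x)%O then
    \sum_(x' in itv (sigma y) x)
       hpoly (fiber_above y x') * (-1) ^+ rho x' x
         * gpoly (dual_set (itv x' x))
  else 0.

(** When [sigma y <= x'] the integer [rB x' - rG y] is nonnegative, since
    [rG y <= rB (sigma y)], and it bounds the degree of [local_h x' y]: the
    poset [fiber_above y z] has rank [rB z - rG y]. *)
Definition mixed_h (x : B) (y : G) : {poly {poly int}} :=
  if (sigma y <= x)%O then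
    \sum_(x' in itv (sigma y) x)
       homog `|rB x' - rG y|%N (local_h x' y)
         * eval1 (gpoly (itv x' x)) (varu * varv)
  else 0.

End Subdivisions.

(* Main.v *)
Require Import Defs.
From mathcomp Require Import all_boot all_order all_algebra.
From mathcomp Require Import boolp.
From mathcomp Require classical_sets.
From mathcomp Require Import zify ring lra.

Set Implicit Arguments.
Unset Strict Implicit.
Unset Printing Implicit Defensive.

Import Order.TTheory GRing.Theory Num.Theory.
Local Open Scope ring_scope.

(** Everything takes place in incidence algebras: functions [P x y] of two poset
    elements with polynomial values of degree at most [r y - r x], multiplied by
    convolution.  Such graded functions carry the involution
    [bar P x y = t^(r y - r x) P x y (t^-1)], which is multiplicative.  With
    [k x y = (t-1)^(rho x y)], the Eulerian condition is [bar k = k^-1], the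
    definition of [g] is [bar g = g k], and the inverse of [g] is
    [(-1)^rho g( [x,y]^* )]: the product of the two is fixed by [bar] but has
    degree less than half of the rank off the diagonal.
    For a subdivision [sigma : G -> B] let [K y x = (t-1)^(rB x - rG y)] when
    [sigma y <= x] and let [D] be its restriction to [sigma y = x].  The definition
    of [h] becomes [bar H = g_G K], and the Eulerian and strong subdivision
    conditions give [K k_B^-1 = D = k_G (bar K)].  Hence [H = bar H k_B^-1], so
    that the local polynomial [L = H g_B^-1] satisfies [bar L = L].  The mixed
    polynomial is the convolution of [v^N L(u/v)] with [g_B(uv)]; since
    homogenization is multiplicative, each claim is an identity in this algebra.
    For a composition [sigma \o tau], [K_tau k_G^-1 K_sigma = K_(sigma \o tau)]
    yields [L_(sigma \o tau) = L_tau L_sigma]. *)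

(** * Homogenization and the incidence algebra *)

Section BinaryForms.

(** The homogenization [b^m p(a/b)]; [revp m] is [bform 1 'X m] and [homog m] is
    [bform varu varv m]. *)
Definition bform (S : comNzRingType) (a b : S) (m : nat) (p : {poly int}) : S :=
  \sum_(i < m.+1) (p`_i)%:~R * a ^+ i * b ^+ (m - i).

Lemma revp_bform m p : revp m p = bform 1 'X m p.
Proof.
rewrite /revp /bform poly_def (reindex_inj rev_ord_inj); apply: eq_bigr => i _.
have lein : (i <= m)%N by rewrite -ltnS.
by rewrite /= subSS subKn // expr1n mulr1 -{1}[p`_i]intz scaler_int mulrzl.
Qed.

Variable S : comNzRingType.
Implicit Types (a b : S) (p q : {poly int}).

Lemma bform0 a b m : bform a b m 0 = 0.
Proof. by rewrite /bform big1 // => i _; rewrite coef0 !mul0r. Qed.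

Lemma bformD a b m p q : bform a b m (p + q) = bform a b m p + bform a b m q.
Proof.
by rewrite /bform -big_split; apply: eq_bigr => i _; rewrite coefD rmorphD /= !mulrDl.
Qed.

Lemma bform_sum a b m (I : Type) (s : seq I) (P : pred I) (F : I -> {poly int}) :
  bform a b m (\sum_(i <- s | P i) F i) = \sum_(i <- s | P i) bform a b m (F i).
Proof. exact: (big_morph _ (bformD a b m) (bform0 a b m)). Qed.

Lemma bform_mulX a b m p : bform a b m.+1 (p * 'X) = a * bform a b m p.
Proof.
rewrite /bform big_ord_recl coefMX /= !mul0r add0r mulr_sumr.
apply: eq_bigr => i _; rewrite coefMX /= subSS exprS.
by rewrite -!mulrA [RHS]mulrCA.
Qed.

Lemma bform_mulC a b m (c : int) p : bform a b m (c%:P * p) = c%:~R * bform a b m p.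
Proof.
by rewrite /bform mulr_sumr; apply: eq_bigr => i _; rewrite coefCM rmorphM /= !mulrA.
Qed.

Lemma bform_wide a b m n p :
  (size p <= n.+1)%N -> bform a b (m + n) p = b ^+ m * bform a b n p.
Proof.
move=> sp; elim: m => [|m IH]; first by rewrite mul1r.
rewrite exprS -mulrA -IH addSn /bform big_ord_recr /=.
rewrite nth_default ?mul0r ?addr0; last by apply: leq_trans sp _; rewrite ltnS; lia.
rewrite mulr_sumr; apply: eq_bigr => i _.
by rewrite subSn ?exprS 1?mulrCA // -ltnS.
Qed.

(** Induction on [m], writing p as p' X + c: the factor X contributes one [a], while the constant c
    of nominal degree m + 1 contributes only powers of [b]. *)
Lemma bformM a b m n p q : (size p <= m.+1)%N -> (size q <= n.+1)%N ->
  bform a b (m + n) (p * q) = bform a b m p * bform a b n q.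
Proof.
elim: m p => [|m IH] p sp sq.
  rewrite [p]size1_polyC // bform_mulC; congr (_ * _).
  by rewrite /bform big_ord1 coefC /= !mulr1.
have -> : p = drop_poly 1 p * 'X + (p`_0)%:P.
  apply/polyP => i; rewrite coefD coefMX coef_drop_poly coefC.
  by case: i => [|i]; rewrite /= ?add0r ?addr0 // addn1.
rewrite mulrDl !bformD mulrDl -mulrA ['X * q]mulrC mulrA addSn !bform_mulX.
rewrite IH ?size_drop_poly //; last by lia.
rewrite mulrA; congr (_ + _).
rewrite bform_mulC -addSn bform_wide // mulrA; congr (_ * _).
rewrite -[(_)%:P]mulr1 bform_mulC; congr (_ * _).
rewrite -[m.+1]addn0 bform_wide ?size_poly1 // /bform big_ord1 coef1 /=.
by rewrite addn0 !mulr1.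
Qed.

Lemma bform_sign a b m n p :
  bform a b m ((-1) ^+ n * p) = (-1) ^+ n * bform a b m p.
Proof.
have -> : (-1 : {poly int}) ^+ n = ((-1) ^+ n)%:P by rewrite rmorphXn rmorphN1.
by rewrite bform_mulC rmorphXn rmorphN1.
Qed.

Lemma bform1 a b : bform a b 0 1 = 1.
Proof. by rewrite /bform big_ord1 coef1 !mulr1. Qed.

Lemma bformXn a b p k m : (size p <= k.+1)%N ->
  bform a b (m * k) (p ^+ m) = bform a b k p ^+ m.
Proof.
move=> sp; elim: m => [|m IH]; first by rewrite !expr0 bform1.
rewrite mulSn !exprS bformM ?IH //.
by apply: leq_trans (size_poly_exp_leq _ _) _; rewrite ltnS; nia.
Qed.

(** Reversing the coefficients exchanges the two variables; the symmetry in u and v ultimately comes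
    from here. *)
Lemma bform_rev a b m p : bform a b m (revp m p) = bform b a m p.
Proof.
rewrite /bform (reindex_inj rev_ord_inj); apply: eq_bigr => i _ /=.
have lein : (i <= m)%N by rewrite -ltnS.
by rewrite subSS coef_poly ltnS leq_subr subKn // mulrAC.
Qed.

Lemma eval1_bform a m p : (size p <= m.+1)%N -> eval1 p a = bform a 1 m p.
Proof.
move=> sp; rewrite (eval1_wide _ sp); apply: eq_bigr => i _.
by rewrite expr1n mulr1.
Qed.

Lemma rmorph_bform (S' : comNzRingType) (f : {rmorphism S -> S'}) a b m p :
  f (bform a b m p) = bform (f a) (f b) m p.
Proof.
rewrite rmorph_sum; apply: eq_bigr => i _.
by rewrite !rmorphM !rmorphXn rmorph_int.
Qed.

End BinaryForms.
Lemma size_revp m p : (size (revp m p) <= m.+1)%N.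
Proof. exact: size_poly. Qed.

Lemma revpK m (p : {poly int}) : (size p <= m.+1)%N -> revp m (revp m p) = p.
Proof.
move=> sp; apply/polyP => i; rewrite !coef_poly.
case: ltnP => [lim | mi]; last by rewrite nth_default // (leq_trans sp).
by rewrite ltnS leq_subr subKn.
Qed.

Lemma size_Xsub1_exp n : (size (('X - 1 : {poly int}) ^+ n) <= n.+1)%N.
Proof. by rewrite size_exp_XsubC. Qed.

(** The form attached to t - 1 is a - b. For a = 1 and b = t this makes [bar] turn powers of t - 1
    into powers of 1 - t. *)
Lemma bform_Xsub1_exp (S : comNzRingType) (a b : S) n :
  bform a b n (('X - 1) ^+ n) = (a - b) ^+ n.
Proof.
rewrite -{1}[n]muln1 bformXn ?size_XsubC //; congr (_ ^+ _).
rewrite /bform !big_ord_recl big_ord0 !coefB !coefX !coef1 /=.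
by rewrite addr0 sub0r !subr0 rmorphN1 rmorph1 /bump subnn !expr1 !mulr1 mul1r mulN1r addrC.
Qed.

Section Eval2.
Variables (S : comNzRingType) (a b : S).

(** [eval1] and [eval2] bundled as ring morphisms, so that they pass through sums, products and
    convolutions. *)
Definition ev1 : {rmorphism {poly int} -> S} :=
  GRing.RMorphism.clone _ _ (horner_eval a \o map_poly intr) _.

Definition ev2 : {rmorphism {poly {poly int}} -> S} :=
  GRing.RMorphism.clone _ _
    (horner_eval a \o map_poly (horner_eval b \o map_poly intr)) _.

Lemma eval1E p : eval1 p a = ev1 p. Proof. by []. Qed.
Lemma eval2E p : eval2 p a b = ev2 p. Proof. by []. Qed.

Lemma ev1_polyX : ev1 'X = a.
Proof. by rewrite /= map_polyX /horner_eval hornerX. Qed.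

Lemma ev2_varu : ev2 varu = a.
Proof. by rewrite /= /varu map_polyX /horner_eval hornerX. Qed.

Lemma ev2_varv : ev2 varv = b.
Proof.
by rewrite /= /varv map_polyC /= /horner_eval hornerC map_polyX hornerX.
Qed.

End Eval2.

Lemma rmorph_ev1 (S S' : comNzRingType) (f : {rmorphism S -> S'}) (a : S) p :
  f (ev1 a p) = ev1 (f a) p.
Proof.
rewrite -!eval1E (eval1_wide _ (leqnn _)) (eval1_wide (f a) (leqnn _)) rmorph_sum.
by apply: eq_bigr => i _; rewrite rmorphM rmorphXn rmorph_int.
Qed.

(** * Convolution of functions of two variables *)

Section Convolution.
Variable S : comNzRingType.

Definition conv (X Y Z : finType) (P : X -> Y -> S) (Q : Y -> Z -> S) : X -> Z -> S :=
  fun x z => \sum_y P x y * Q y z.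

Definition delta (X : finType) : X -> X -> S := fun x y => (x == y)%:R.

Lemma funext2 (X Y : Type) (P Q : X -> Y -> S) : (forall x y, P x y = Q x y) -> P = Q.
Proof. by move=> PQ; apply/funext => x; apply/funext => y. Qed.

Lemma convA (X Y Z W : finType) (P : X -> Y -> S) (Q : Y -> Z -> S) (R : Z -> W -> S) :
  conv P (conv Q R) = conv (conv P Q) R.
Proof.
apply: funext2 => x w; rewrite /conv.
under eq_bigr do rewrite mulr_sumr.
rewrite exchange_big; apply: eq_bigr => z _ /=.
by rewrite mulr_suml; apply: eq_bigr => y _; rewrite mulrA.
Qed.

Lemma conv_deltal (X Y : finType) (P : X -> Y -> S) : conv (@delta X) P = P.
Proof.
apply: funext2 => x y; rewrite /conv (bigD1 x) //= /delta eqxx mul1r big1 ?addr0 //.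
by move=> z /negPf zx; rewrite eq_sym zx mul0r.
Qed.

Lemma conv_deltar (X Y : finType) (P : X -> Y -> S) : conv P (@delta Y) = P.
Proof.
apply: funext2 => x y; rewrite /conv (bigD1 y) //= /delta eqxx mulr1 big1 ?addr0 //.
by move=> z /negPf zx; rewrite zx mulr0.
Qed.

(** Functions on X x X are square matrices over a commutative ring, where a right inverse is also a
    left inverse. *)
Lemma conv_inverse_comm (X : finType) (P Q : X -> X -> S) :
  conv P Q = @delta X -> conv Q P = @delta X.
Proof.
pose mx (R : X -> X -> S) : 'M_#|X| := \matrix_(i, j) R (enum_val i) (enum_val j).
have mxM R R' : mx R *m mx R' = mx (conv R R').
  apply/matrixP => i j; rewrite !mxE /conv [RHS](big_enum_val (fun y => _)) /=.
  by apply: eq_bigr => k _; rewrite !mxE.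
have mx1 : mx (@delta X) = 1%:M.
  by apply/matrixP => i j; rewrite !mxE /delta (inj_eq enum_val_inj).
move=> PQ; have /mulmx1C : mx P *m mx Q = 1%:M by rewrite mxM PQ.
rewrite mxM -mx1 => /matrixP QP; apply: funext2 => x y.
by have := QP (enum_rank x) (enum_rank y); rewrite !mxE !enum_rankK.
Qed.

End Convolution.
Arguments delta S X : clear implicits.

Lemma rmorph_conv (S S' : comNzRingType) (f : {rmorphism S -> S'}) (X Y Z : finType)
    (P : X -> Y -> S) (Q : Y -> Z -> S) x z :
  f (conv P Q x z) = conv (fun x y => f (P x y)) (fun y z => f (Q y z)) x z.
Proof. by rewrite rmorph_sum; apply: eq_bigr => y _; rewrite rmorphM. Qed.

(** * Graded functions and the bar involution *)

Section Graded.

(** Rank differences enter as absolute values, which add up only when they are nonnegative; hence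
    the sign condition at every nonzero value. *)
Definition graded (X Y : Type) (rX : X -> int) (rY : Y -> int)
    (P : X -> Y -> {poly int}) : Prop :=
  forall x y, P x y = 0 \/ rX x <= rY y /\ (size (P x y) <= `|rY y - rX x|%N.+1)%N.

Definition gform (S : comNzRingType) (X Y : Type) (rX : X -> int) (rY : Y -> int)
    (a b : S) (P : X -> Y -> {poly int}) : X -> Y -> S :=
  fun x y => bform a b `|rY y - rX x|%N (P x y).

(** [bar P x y] is [t^(rY y - rX x) P x y (t^-1)]. *)
Definition bar (X Y : Type) (rX : X -> int) (rY : Y -> int) (P : X -> Y -> {poly int}) :
    X -> Y -> {poly int} :=
  gform rX rY 1 'X P.

Section Conv.
Variables (X Y Z : finType) (rX : X -> int) (rY : Y -> int) (rZ : Z -> int).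
Variables (P : X -> Y -> {poly int}) (Q : Y -> Z -> {poly int}).
Hypotheses (gP : graded rX rY P) (gQ : graded rY rZ Q).

Let size_term x y z : P x y * Q y z = 0 \/ rX x <= rY y /\ rY y <= rZ z /\
  (size (P x y) <= `|rY y - rX x|%N.+1)%N /\ (size (Q y z) <= `|rZ z - rY y|%N.+1)%N.
Proof.
have [-> | [? ?]] := gP x y; first by left; rewrite mul0r.
by have [-> | [? ?]] := gQ y z; [left; rewrite mulr0 | right].
Qed.

Lemma graded_conv : graded rX rZ (conv P Q).
Proof.
move=> x z; have [xz | zx] := leP (rX x) (rZ z); [right; split=> // | left].
  apply: (leq_trans (size_sum _ _ _)); apply/bigmax_leqP => y _.
  have [-> | [? [? [sP sQ]]]] := size_term x y z; first by rewrite size_poly0.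
  by apply: (leq_trans (size_polyMleq _ _)); lia.
rewrite /conv big1 // => y _.
by have [-> // | [xy [yz _]]] := size_term x y z; lia.
Qed.

(** In a nonzero term both rank differences are nonnegative, so the two degree bounds add up to that
    of the product and [bformM] applies. *)
Lemma gform_conv (S : comNzRingType) (a b : S) :
  gform rX rZ a b (conv P Q) = conv (gform rX rY a b P) (gform rY rZ a b Q).
Proof.
apply: funext2 => x z; rewrite /gform /conv bform_sum; apply: eq_bigr => y _.
have [-> | [? ?]] := gP x y; first by rewrite mul0r !bform0 mul0r.
have [-> | [? ?]] := gQ y z; first by rewrite mulr0 !bform0 mulr0.
rewrite -bformM //; congr bform; lia.
Qed.

Lemma bar_conv : bar rX rZ (conv P Q) = conv (bar rX rY P) (bar rY rZ Q).
Proof. exact: gform_conv. Qed.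

End Conv.

Lemma barE (X Y : Type) (rX : X -> int) (rY : Y -> int) P x y :
  bar rX rY P x y = revp `|rY y - rX x|%N (P x y).
Proof. by rewrite revp_bform. Qed.

Section Bar.
Variables (X Y : Type) (rX : X -> int) (rY : Y -> int) (P : X -> Y -> {poly int}).
Hypothesis gP : graded rX rY P.

Lemma graded_bar : graded rX rY (bar rX rY P).
Proof.
move=> x y; rewrite barE; have [-> | [? ?]] := gP x y.
  by left; rewrite revp_bform bform0.
by right; rewrite size_revp.
Qed.

Lemma barK : bar rX rY (bar rX rY P) = P.
Proof.
apply: funext2 => x y; rewrite !barE; have [-> | [? ?]] := gP x y.
  by rewrite !revp_bform !bform0.
by rewrite revpK.
Qed.

End Bar.

Lemma gform_bar (S : comNzRingType) (X Y : Type) (rX : X -> int) (rY : Y -> int)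
    (a b : S) P :
  gform rX rY a b (bar rX rY P) = gform rX rY b a P.
Proof. by apply: funext2 => x y; rewrite /gform barE bform_rev. Qed.

Lemma gform_delta (S : comNzRingType) (X : finType) (rX : X -> int) (a b : S) :
  gform rX rX a b (delta _ X) = delta S X.
Proof.
apply: funext2 => x y; rewrite /gform /delta; have [-> | _] := eqVneq x y.
  by rewrite subrr bform1.
by rewrite bform0.
Qed.

End Graded.

(** * Eulerian posets *)

Section Chains.
Context {d : Order.disp_t} {T : finPOrderType d}.
Implicit Types (A C : {set T}) (x y z : T).

Lemma is_chainP C : reflect {in C &, forall x y, (x >=< y)%O} (is_chain C).
Proof.
apply: (iffP forall_inP) => [cC x y xC yC | cC x xC]; first exact: (forall_inP (cC x xC)).
by apply/forall_inP => y; apply: cC.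
Qed.

Lemma mem_itv_in A x y z : (z \in itv_in A x y) = [&& z \in A, (x <= z)%O & (z <= y)%O].
Proof. by rewrite inE. Qed.

Lemma mem_itv x y z : (z \in itv x y) = (x <= z)%O && (z <= y)%O.
Proof. by rewrite !inE. Qed.

Lemma card_chain_le_rk A C : chain_in A C -> (#|C|.-1 <= rk A)%N.
Proof. exact: (@leq_bigmax_cond _ _ (fun C : {set T} => #|C|.-1)). Qed.

Lemma rk_exists A : exists2 C, chain_in A C & #|C|.-1 = rk A.
Proof.
have c0 : chain_in A set0.
  by rewrite /chain_in sub0set; apply/is_chainP => x y; rewrite inE.
have : (0 < #|[pred C | chain_in A C]|)%N by apply/card_gt0P; exists set0.
move=> /(@eq_bigmax_cond _ _ (fun C : {set T} => #|C|.-1)) [C cC eC].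
by exists C; rewrite // /rk eC.
Qed.

Lemma rkS A A' : A \subset A' -> (rk A <= rk A')%N.
Proof.
move=> AA'; have [C /andP[CA cC] <-] := rk_exists A; apply: card_chain_le_rk.
by rewrite /chain_in cC (subset_trans CA).
Qed.

Lemma rk_le1 A : (#|A| <= 1)%N -> rk A = 0%N.
Proof.
move=> A1; have [C /andP[/subset_leq_card CA _] <-] := rk_exists A; lia.
Qed.

Lemma rho_in_refl A x : rho_in A x x = 0%N.
Proof.
apply: rk_le1; rewrite -(cards1 x); apply: subset_leq_card; apply/subsetP => z.
by rewrite mem_itv_in inE => /and3P[_ xz zx]; rewrite eq_le xz zx.
Qed.

Lemma rk_gt0 A x y : x \in A -> y \in A -> (x < y)%O -> (0 < rk A)%N.
Proof.
move=> xA yA xy; have cxy := lt_comparable xy; have ch : chain_in A [set x; y].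
  apply/andP; split; first by apply/subsetP => z; rewrite !inE => /orP[] /eqP ->.
  apply/is_chainP => a b; rewrite !inE => /orP[] /eqP -> /orP[] /eqP ->;
    by rewrite ?comparablexx ?cxy // comparable_sym cxy.
by apply: leq_trans (card_chain_le_rk ch); rewrite cards2 (lt_eqF xy).
Qed.

Lemma rho_in_gt0 A x y : x \in A -> y \in A -> (x < y)%O -> (0 < rho_in A x y)%N.
Proof.
by move=> xA yA xy; apply: (rk_gt0 _ _ xy); rewrite mem_itv_in ?xA ?yA lexx (ltW xy).
Qed.

Lemma itv_in_itv_in A x y a b : (x <= a)%O -> (b <= y)%O ->
  itv_in (itv_in A x y) a b = itv_in A a b.
Proof.
move=> xa lby; apply/setP => z; rewrite !mem_itv_in.
case: (z \in A) => //=; case az: (a <= z)%O; rewrite ?andbF //=; case zb: (z <= b)%O.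
  by rewrite (le_trans xa az) (le_trans zb lby).
by rewrite andbF.
Qed.

Lemma rho_in_itv_in A x y a b : (x <= a)%O -> (b <= y)%O ->
  rho_in (itv_in A x y) a b = rho_in A a b.
Proof. by move=> xa lby; rewrite /rho_in itv_in_itv_in. Qed.

Lemma is_chainU1 C x : is_chain C -> {in C, forall y, (x >=< y)%O} -> is_chain (x |: C).
Proof.
move=> /is_chainP cC xC; apply/is_chainP => a b; rewrite !inE.
move=> /predU1P[-> | aC] /predU1P[-> | bC]; [exact: comparablexx | exact: xC | |].
  by rewrite comparable_sym xC.
exact: cC.
Qed.

Lemma maxchain_mem A C x : maxset (chain_in A) C -> x \in A ->
  {in C, forall y, (x >=< y)%O} -> x \in C.
Proof.
move=> /maxsetP[/andP[CA cC] mC] xA xC.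
rewrite -(mC (x |: C)) ?setU11 ?subsetUr //.
by rewrite /chain_in is_chainU1 // subUset sub1set xA CA.
Qed.

Lemma maxchain_exists A : exists C, maxset (chain_in A) C.
Proof.
have c0 : chain_in A set0.
  by rewrite /chain_in sub0set; apply/is_chainP => x y; rewrite inE.
by have [C mC _] := maxset_exists c0; exists C.
Qed.

(** A maximal chain of [x,y] and one of [y,z], glued at y, form a maximal chain of [x,z]; in a
    locally graded poset these three chains compute the three lengths. *)
Lemma rho_in_add A x y z : locally_graded A -> x \in A -> y \in A -> z \in A ->
  (x <= y)%O -> (y <= z)%O -> rho_in A x z = (rho_in A x y + rho_in A y z)%N.
Proof.
move=> lgA xA yA zA xy yz.
have [C1 m1] := maxchain_exists (itv_in A x y).
have [C2 m2] := maxchain_exists (itv_in A y z).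
rewrite -(lgA _ _ xA yA xy _ m1) -(lgA _ _ yA zA yz _ m2).
have /maxsetP[/andP[/subsetP s1 c1] _] := m1.
have /maxsetP[/andP[/subsetP s2 c2] _] := m2.
have le1 a : a \in C1 -> (a <= y)%O by move=> /s1; rewrite mem_itv_in => /and3P[].
have le2 a : a \in C2 -> (y <= a)%O by move=> /s2; rewrite mem_itv_in => /and3P[].
have y1 : y \in C1.
  apply: (maxchain_mem m1); first by rewrite mem_itv_in yA xy lexx.
  by move=> a /le1; apply: ge_comparable.
have y2 : y \in C2.
  apply: (maxchain_mem m2); first by rewrite mem_itv_in yA yz lexx.
  by move=> a /le2; apply: le_comparable.
have C12 : C1 :&: C2 = [set y].
  apply/setP => a; rewrite !inE; apply/andP/eqP => [[/le1 ay /le2 ya] | -> //].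
  by apply/eqP; rewrite eq_le ay ya.
have m : maxset (chain_in (itv_in A x z)) (C1 :|: C2).
  apply/maxsetP; split.
    apply/andP; split.
      apply/subsetP => a; rewrite inE mem_itv_in => /orP[aC | aC].
        have := s1 a aC; rewrite mem_itv_in => /and3P[-> -> /le_trans]; exact.
      by have := s2 a aC; rewrite mem_itv_in => /and3P[-> /(le_trans xy) -> ->].
    apply/is_chainP => a b; rewrite !inE => /orP[] aC /orP[] bC.
    - by move/is_chainP: c1; apply.
    - by apply: le_comparable; apply: le_trans (le1 _ aC) (le2 _ bC).
    - by apply: ge_comparable; apply: le_trans (le1 _ bC) (le2 _ aC).
    - by move/is_chainP: c2; apply.
  move=> D /andP[/subsetP sD /is_chainP cD] /subsetP CD.
  apply/eqP; rewrite eqEsubset; apply/andP; split; last exact/subsetP.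
  apply/subsetP => a aD; rewrite inE; apply/orP.
  have := sD a aD; rewrite mem_itv_in => /and3P[aA xa az].
  (* Each element of D is comparable with y, hence lies in [x,y] or in [y,z], where maximality of
     [C1] or [C2] captures it. *)
  have yD : y \in D by apply: CD; rewrite inE y1.
  have /orP[ay | ya] := cD a y aD yD; [left | right].
    apply: (maxchain_mem m1); first by rewrite mem_itv_in aA xa ay.
    by move=> b bC; apply: cD aD _; apply: CD; rewrite inE bC.
  apply: (maxchain_mem m2); first by rewrite mem_itv_in aA ya az.
  by move=> b bC; apply: cD aD _; apply: CD; rewrite inE bC orbT.
rewrite -(lgA _ _ xA zA (le_trans xy yz) _ m) cardsU C12 cards1.
(* The chains share y, and lengths are truncated predecessors of cardinalities, so nonemptiness is
   needed for the count. *)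
have : (0 < #|C1|)%N by apply/card_gt0P; exists y.
have : (0 < #|C2|)%N by apply/card_gt0P; exists y.
lia.
Qed.

End Chains.

Section EulerianIntervals.
Context {d : Order.disp_t} {T : finPOrderType d}.
Implicit Types (A : {set T}) (x y z : T).

Lemma is_minimum_itv_in A x y : x \in A -> (x <= y)%O -> is_minimum (itv_in A x y) x.
Proof.
by move=> xA xy; split=> [|z]; rewrite mem_itv_in ?xA ?lexx // => /and3P[].
Qed.

Lemma is_maximum_itv_in A x y : y \in A -> (x <= y)%O -> is_maximum (itv_in A x y) y.
Proof.
by move=> yA xy; split=> [|z]; rewrite mem_itv_in ?yA ?lexx ?xy // => /and3P[].
Qed.

Lemma Eulerian_itv_in A x y : Eulerian A -> x \in A -> y \in A -> (x <= y)%O ->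
  Eulerian (itv_in A x y).
Proof.
case=> lgA _ _ evA xA yA xy; split.
- move=> a b; rewrite !mem_itv_in => /and3P[aA xa ay] /and3P[bA xb lby] ab C.
  by rewrite itv_in_itv_in // rho_in_itv_in //; apply: lgA.
- by exists x; apply: is_minimum_itv_in.
- by exists y; apply: is_maximum_itv_in.
move=> a b; rewrite !mem_itv_in => /and3P[aA xa ay] /and3P[bA xb lby] ab.
rewrite itv_in_itv_in // rho_in_itv_in // => rab; have := evA a b aA bA ab rab.
have e z : z \in itv_in A a b -> rho_in (itv_in A x y) a z = rho_in A a z.
  rewrite mem_itv_in => /and3P[_ _ zb]; apply: rho_in_itv_in => //.
  exact: le_trans zb lby.
have eset (P : nat -> bool) :
    [set z in itv_in A a b | P (rho_in (itv_in A x y) a z)] =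
    [set z in itv_in A a b | P (rho_in A a z)].
  apply/setP => z; rewrite in_set [RHS]in_set.
  by case zI: (z \in itv_in A a b); rewrite //= e.
by rewrite (eset odd) (eset (fun n => ~~ odd n)).
Qed.

Lemma locally_Eulerian_Eulerian A : Eulerian A -> locally_Eulerian A.
Proof. by move=> EA x y xA yA; apply: Eulerian_itv_in. Qed.

Lemma itv_in_min_max A a b : is_minimum A a -> is_maximum A b -> itv_in A a b = A.
Proof.
move=> [_ ma] [_ mb]; apply/setP => z; rewrite mem_itv_in.
by case zA: (z \in A); rewrite //= ma // mb.
Qed.

(** Elements of even rank contribute 1 and those of odd rank -1, so the equality of the two counts
    is the vanishing of the alternating sum. *)
Lemma Eulerian_sum (S : comNzRingType) A x y : Eulerian A -> x \in A -> y \in A ->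
  (x < y)%O -> \sum_(z in itv_in A x y) (-1 : S) ^+ rho_in A x z = 0.
Proof.
case=> _ _ _ evA xA yA xy.
have := evA x y xA yA (ltW xy) (rho_in_gt0 xA yA xy).
rewrite (bigID (fun z => odd (rho_in A x z))) /= => ev.
rewrite (eq_bigr (fun=> -1)) => [|z /andP[_ oz]]; last by rewrite -signr_odd oz.
rewrite [X in _ + X](eq_bigr (fun=> 1)) => [|z /andP[_ oz]]; last first.
  by rewrite -signr_odd (negPf oz).
rewrite !sumr_const mulNrn; apply/eqP; rewrite addrC subr_eq0; apply/eqP; congr (_ *+ _).
transitivity #|[set z in itv_in A x y | ~~ odd (rho_in A x z)]|.
  by apply: eq_card => z; rewrite [RHS]in_set.
by rewrite ev; apply: eq_card => z; rewrite [LHS]in_set.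
Qed.

End EulerianIntervals.

(** * Existence of the g-polynomial *)

Section GpolyExists.
Context {d : Order.disp_t} {T : finPOrderType d}.
Implicit Types (A : {set T}) (x y z : T) (g : {set T} -> {poly int}).

(** The defining condition at a single poset and for a plain function, which allows a recursion on
    cardinality. *)
Definition gpoly_at g A : Prop :=
  (rk A = 0%N -> g A = 1) /\
  ((0 < rk A)%N -> ((size (g A)).-1.*2 < rk A)%N /\ revp (rk A) (g A) = gsum g A).

Lemma in_down A x z : (z \in down A x) = (z \in A) && (z <= x)%O.
Proof. by rewrite inE. Qed.

Lemma down_itv_in A a x : is_minimum A a -> down A x = itv_in A a x.
Proof.
move=> [_ ma]; apply/setP => z; rewrite in_down mem_itv_in.
by case zA: (z \in A) => //=; rewrite ma.
Qed.

Lemma down_down A x y : (y <= x)%O -> down (down A x) y = down A y.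
Proof.
move=> yx; apply/setP => z; rewrite !in_down -andbA; congr (_ && _).
by case zy: (z <= y)%O; rewrite ?andbF // (le_trans zy yx).
Qed.

Lemma down_max A b : is_maximum A b -> down A b = A.
Proof.
by move=> [_ mb]; apply/setP => z; rewrite in_down; case zA: (z \in A); rewrite //= mb.
Qed.

Lemma down_subset A x : down A x \subset A.
Proof. by apply/subsetP => z; rewrite in_down => /andP[]. Qed.

Lemma gpoly_at_size g A : gpoly_at g A -> (size (g A) <= (rk A).+1)%N.
Proof.
case=> g0 g1; have [/g0 -> | /g1[sg _]] := posnP (rk A); first by rewrite size_poly1.
by rewrite -addnn in sg; lia.
Qed.

Lemma rk0_min A a : is_minimum A a -> rk A = 0%N -> A = [set a].
Proof.
move=> [aA ma] rA; apply/setP => x; rewrite inE; apply/idP/eqP => [xA | -> //].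
apply/eqP; apply: contraT => xa.
by have := rk_gt0 aA xA; rewrite lt_def xa ma // rA => /(_ isT).
Qed.

Lemma gpoly_at_revp g A : Eulerian A -> gpoly_at g A -> revp (rk A) (g A) = gsum g A.
Proof.
move=> [_ [a minA] _ _] [g0 g1]; have [rA | /g1[] //] := posnP (rk A).
have gA := g0 rA; have eA := rk0_min minA rA.
rewrite gA rA /gsum rA {1}eA big_set1 sub0n expr0 mulr1.
rewrite (down_max (A := A) (b := a)); first by rewrite gA revp_bform bform1.
by split=> [|z]; rewrite eA inE // => /eqP ->.
Qed.

(** [gsum] without its top term: only values of [g] at proper lower intervals occur, which the
    recursion already knows. *)
Definition glow g A : {poly int} :=
  \sum_(x in A | down A x != A) g (down A x) * ('X - 1) ^+ (rk A - rk (down A x)).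

(** Solves [revp n p = p + glow g A] for [p] of degree less than [n/2]. *)
Definition gstep g A : {poly int} :=
  if rk A == 0%N then 1 else \poly_(i < uphalf (rk A)) - (glow g A)`_i.

Lemma gsum_glow g A : Eulerian A -> gsum g A = g A + glow g A.
Proof.
case=> _ _ [b maxA] _; rewrite /gsum /glow (bigD1 b) /=; last by case: maxA.
rewrite down_max // subnn mulr1; congr (_ + _); apply: eq_bigl => x.
case xA: (x \in A) => //=; congr (~~ _); apply/eqP/eqP => [-> | dx].
  exact: down_max.
have [bA mb] := maxA; apply/eqP; rewrite eq_le mb //=.
by move: bA; rewrite -{1}dx in_down => /andP[].
Qed.

Lemma down_Eulerian A x : Eulerian A -> x \in A -> Eulerian (down A x).
Proof.
move=> EA xA; have [_ [a minA] _ _] := EA; rewrite (down_itv_in _ minA).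
by have [aA ma] := minA; apply: Eulerian_itv_in => //; apply: ma.
Qed.

Lemma rk_down A a x y : Eulerian A -> is_minimum A a -> x \in A -> y \in A -> (x <= y)%O ->
  rk (down A y) = (rk (down A x) + rho_in A x y)%N.
Proof.
move=> [lgA _ _ _] minA xA yA xy; rewrite !(down_itv_in _ minA).
by have [aA ma] := minA; apply: rho_in_add => //; apply: ma.
Qed.

(** This antisymmetry makes the equation for g solvable. Expanding the reversed g([0,x]) by its own
    recursion and exchanging the sums, g([0,y]) gets the factor (t-1)^(n - rk y) times the sum of
    (-1)^(n - rk x) over y <= x < 1, which is -1 because [y,1] is Eulerian. *)
Lemma glow_antisym g A : Eulerian A ->
  (forall A', Eulerian A' -> (#|A'| < #|A|)%N -> gpoly_at g A') ->
  revp (rk A) (glow g A) = - glow g A.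
Proof.
move=> EA gA; have [_ [a minA] [b maxA] _] := EA; have [bA mb] := maxA.
have low x : x \in A -> down A x != A -> gpoly_at g (down A x).
  move=> xA xb; apply: gA; first exact: down_Eulerian.
  by apply: proper_card; rewrite properEneq xb down_subset.
have lowE x : x \in A -> (down A x != A) = (x != b).
  move=> xA; congr (~~ _); apply/eqP/eqP => [dx | ->]; last exact: down_max.
  apply/eqP; rewrite eq_le mb //=.
  by move: bA; rewrite -{1}dx in_down => /andP[].
have Rle x : (rk (down A x) <= rk A)%N by apply/rkS/down_subset.
rewrite revp_bform bform_sum.
(* Here (t-1)^rho(y,x) comes from the recursion for g([0,x]) and (1-t)^rho(x,1) from the reversal;
   together they give a power independent of x, up to sign. *)
pose F x y := g (down A y) * ('X - 1 : {poly int}) ^+ (rk A - rk (down A y)) *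
  (-1) ^+ (rk A - rk (down A x)).
transitivity (\sum_(x in A | down A x != A) \sum_(y in A | (y <= x)%O) F x y).
  apply: eq_bigr => x /andP[xA xb].
  rewrite -[in LHS](subnKC (Rle x)) bformM ?addKn ?size_Xsub1_exp //; last first.
    exact: gpoly_at_size (low x xA xb).
  rewrite -revp_bform gpoly_at_revp; [|exact: down_Eulerian|exact: low].
  rewrite bform_Xsub1_exp -opprB exprNn mulr_suml /gsum.
  apply: eq_big => [y | y]; first by rewrite in_down.
  rewrite in_down => /andP[yA yx]; rewrite /F down_down //.
  have := rk_down EA minA yA xA yx; have := Rle x; have := Rle y.
  move: (rk (down A y)) (rk (down A x)) (rk A) (rho_in _ _ _) => i j n k ix jx e.
  have -> : (n - i = (j - i) + (n - j))%N by lia.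
  by rewrite exprD; ring.
rewrite (exchange_big_dep (mem A)) /= => [|x y _ /andP[] //].
(* The top element y = b lies below no x < b, so its inner sum is empty. *)
rewrite /glow -sumrN [LHS](bigID (fun y => down A y != A)) /=.
rewrite [X in _ + X]big1 ?addr0 => [|y /andP[yA]]; last first.
  rewrite lowE // negbK => /eqP ->; rewrite big_pred0 // => x; apply/negP.
  case/andP=> /andP[xA]; rewrite lowE // => xb /andP[_ bx].
  by case/eqP: xb; apply/eqP; rewrite eq_le mb.
apply: eq_bigr => y /andP[yA yb]; rewrite /F -mulr_sumr -[RHS]mulrN1; congr (_ * _).
have yb' : (y < b)%O by rewrite lt_def eq_sym mb // -lowE // yb.
(* The alternating sum over [y,b] is solved for its terms with x < b. Its signs count from y;
   multiplying by (-1)^rho(y,b) makes them count from b. *)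
have := Eulerian_sum {poly int} EA yA bA yb'.
rewrite (bigD1 b) /=; last by rewrite mem_itv_in bA lexx (ltW yb').
have rb := rk_down EA minA yA bA (ltW yb'); rewrite (down_max maxA) in rb.
move=> /eqP; rewrite addrC addr_eq0 => /eqP e.
transitivity ((-1 : {poly int}) ^+ rho_in A y b * (- (-1) ^+ rho_in A y b)); last first.
  by rewrite mulrN -exprD addnn -mul2n exprM sqrrN expr1n expr1n.
rewrite -e mulr_sumr; apply: eq_big => [x | x].
  rewrite mem_itv_in yA; case xA: (x \in A); rewrite ?andbF //= mb // andbT.
  by rewrite lowE // andbC.
move=> /andP[/andP[xA xb] /andP[_ yx]].
have := rk_down EA minA yA xA yx; have := Rle x; rewrite rb => le1 e1.
rewrite -exprD -signr_odd -[RHS]signr_odd; congr (_ ^+ nat_of_bool _).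
by rewrite oddD -oddB; [congr odd; lia | lia].
Qed.

Lemma gstep_gpoly_at g A : Eulerian A ->
  (forall A', Eulerian A' -> (#|A'| < #|A|)%N -> gpoly_at g A') ->
  forall g', g' A = gstep g A -> (forall A', (#|A'| < #|A|)%N -> g' A' = g A') ->
  gpoly_at g' A.
Proof.
move=> EA gA g' g'A g'low; split=> [rA | rA]; rewrite g'A /gstep; first by rewrite rA.
have low : glow g' A = glow g A.
  rewrite /glow; apply: eq_bigr => x /andP[xA xb]; rewrite g'low //.
  by apply: proper_card; rewrite properEneq xb down_subset.
rewrite gsum_glow // low g'A /gstep eqn0Ngt rA /=.
have := glow_antisym EA gA; move: (glow g A) (rk A) rA => f n n0 anti; split.
  (* For positive n, degree below n/2 means size at most [uphalf n]. *)
  by have := size_poly (uphalf n) (fun i => - f`_i); move: (size _) => s; lia.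
apply/polyP => i; have := congr1 (fun p : {poly int} => p`_i) anti.
rewrite coefD coefN !coef_poly ltnS.
(* A middle coefficient is its own negative, hence zero. Otherwise exactly one of i and n - i lies
   below n/2, and antisymmetry matches the two coefficients. *)
have [-> | ii] := eqVneq (n - i)%N i; move: f`_i => a.
  by case: ifP => _; case: ifP => _ e; lra.
move: f`_(n - i) => b; case: (leqP i n) => lin; last by case: ifP => _ e; lra.
by case: (ltnP i (uphalf n)) => c1; case: (ltnP (n - i) (uphalf n)) => c2 e;
  (lra || lia).
Qed.

(** For each k a function is built that is correct on Eulerian sets with fewer than k elements,
    using [gstep] at the next cardinality; one k exceeds all cardinalities in the finite type. *)
Lemma gpoly_exists : exists g : {ffun {set T} -> {poly int}}, is_gpoly g.
Proof.
suff ex k : exists g, forall A, Eulerian A -> (#|A| < k)%N -> gpoly_at g A.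
  have [g gP] := ex #|T|.+1; exists [ffun A => g A] => A EA.
  have [g0 g1] := gP A EA (max_card _); rewrite ffunE; split=> // /g1[sg gE].
  by split=> //; rewrite gE; apply: eq_bigr => x _; rewrite ffunE.
elim: k => [|k [g gP]]; first by exists (fun=> 0).
exists (fun A => if (#|A| < k)%N then g A else gstep g A) => A EA.
rewrite ltnS leq_eqVlt => /orP[/eqP Ak | Ak].
  apply: (@gstep_gpoly_at g) => //; rewrite ?Ak ?ltnn // => A' //.
  by move=> ->.
have [g0 g1] := gP A EA Ak; rewrite /gpoly_at Ak; split=> // /g1[sg gE].
split=> //; rewrite gE; apply: eq_bigr => x _.
by rewrite (leq_ltn_trans (subset_leq_card (down_subset A x)) Ak).
Qed.

(** Since a solution exists, the choice made by [xget] is a solution and not the default. *)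
Lemma gpolyP A : Eulerian A -> gpoly_at (@gpoly d T) A.
Proof.
move=> EA; have [g gP] := gpoly_exists.
exact: (classical_sets.xgetPex [ffun=> 0] (ex_intro _ g gP)) EA.
Qed.

End GpolyExists.

(** * Dual posets *)

Section Duality.
Context {d : Order.disp_t} {T : finPOrderType d}.
Implicit Types (A C : {set T}) (x y z : T).

Lemma in_dual_set A (z : T^d) : (z \in dual_set A) = ((z : T) \in A).
Proof. by rewrite inE. Qed.

Definition undual_set (A : {set T^d}) : {set T} := [set z : T | (z : T^d) \in A].

Lemma dual_setK : cancel (@dual_set d T) undual_set.
Proof. by move=> A; apply/setP => z; rewrite inE in_dual_set. Qed.

Lemma undual_setK : cancel undual_set (@dual_set d T).
Proof. by move=> A; apply/setP => z; rewrite in_dual_set inE. Qed.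

Lemma card_dual_set A : #|dual_set A| = #|A|.
Proof.
rewrite -[LHS](card_image (f := fun z : T^d => (z : T))) //; apply: eq_card => z.
apply/imageP/idP => [[y] | zA]; first by rewrite in_dual_set => yA ->.
by exists z; rewrite ?in_dual_set.
Qed.

Lemma dual_setS A C : (dual_set A \subset dual_set C) = (A \subset C).
Proof.
apply/subsetP/subsetP => AC z zA; first by have := AC z; rewrite !in_dual_set; apply.
by rewrite in_dual_set; apply: AC; rewrite in_dual_set in zA.
Qed.

Lemma chain_in_dual A C : chain_in (dual_set A) (dual_set C) = chain_in A C.
Proof.
rewrite /chain_in dual_setS; congr (_ && _); apply/is_chainP/is_chainP => cC x y xC yC.
  by have := cC x y; rewrite !in_dual_set /Order.comparable orbC; apply.
by rewrite !in_dual_set in xC yC; have := cC x y xC yC; rewrite /Order.comparable orbC.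
Qed.

Lemma rk_dual_set A : rk (dual_set A) = rk A.
Proof.
apply/eqP; rewrite eqn_leq; apply/andP; split.
  have [C cC <-] := rk_exists (dual_set A).
  by rewrite -(undual_setK C) card_dual_set card_chain_le_rk // -chain_in_dual undual_setK.
have [C cC <-] := rk_exists A.
by rewrite -card_dual_set card_chain_le_rk // chain_in_dual.
Qed.

Lemma itv_in_dual A x y : itv_in (dual_set A) (y : T^d) x = dual_set (itv_in A x y).
Proof.
by apply/setP => z; rewrite in_dual_set !mem_itv_in in_dual_set [X in _ && X]andbC.
Qed.

Lemma rho_in_dual A x y : rho_in (dual_set A) (y : T^d) x = rho_in A x y.
Proof. by rewrite /rho_in itv_in_dual rk_dual_set. Qed.

Lemma locally_graded_dual A : locally_graded A -> locally_graded (dual_set A).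
Proof.
move=> lgA y x; rewrite !in_dual_set => yA xA yx C mC.
rewrite itv_in_dual in mC; rewrite rho_in_dual -(lgA x y xA yA yx (undual_set C)).
  by rewrite -card_dual_set undual_setK.
move/maxsetP: mC => [cC mC]; apply/maxsetP; split.
  by rewrite -chain_in_dual undual_setK.
move=> D cD CD; rewrite -(dual_setK D); congr undual_set; apply: mC.
  by rewrite chain_in_dual.
by rewrite -(undual_setK C) dual_setS.
Qed.

(** By additivity, rho(z,y) has the parity of rho(x,y) + rho(x,z). Counting ranks from the other end
    thus keeps or interchanges the even and odd elements, and equality of their numbers survives. *)
Lemma Eulerian_dual A : Eulerian A -> Eulerian (dual_set A).
Proof.
move=> EA; have [lgA [a [aA ma]] [b [bA mb]] evA] := EA; split.
- exact: locally_graded_dual.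
- by exists b; split=> [|z]; rewrite in_dual_set //; apply: mb.
- by exists a; split=> [|z]; rewrite in_dual_set //; apply: ma.
move=> y x; rewrite !in_dual_set => yA xA yx; rewrite rho_in_dual => rxy.
have := evA x y xA yA yx rxy.
have sE (P : nat -> bool) :
    #|[set z in itv_in (dual_set A) y x | P (rho_in (dual_set A) y z)]| =
    #|[set z in itv_in A x y | P (rho_in A z y)]|.
  rewrite -card_dual_set; apply: eq_card => z.
  by rewrite [LHS]in_set itv_in_dual !in_dual_set [RHS]in_set rho_in_dual.
rewrite (sE odd) (sE (fun n => ~~ odd n)).
have oE z : z \in itv_in A x y ->
    odd (rho_in A z y) = odd (rho_in A x y) (+) odd (rho_in A x z).
  rewrite mem_itv_in => /and3P[zA xz zy].
  by rewrite (rho_in_add lgA xA zA yA) // oddD addbAC addbb.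
have [ox | ex] := boolP (odd (rho_in A x y)).
  move=> /esym e; apply: etrans (etrans _ e) _; apply: eq_card => z;
    rewrite in_set [RHS]in_set; case zI: (z \in itv_in A x y) => //=.
    by rewrite oE // ox negbK.
  by rewrite oE // ox.
move=> e; apply: etrans (etrans _ e) _; apply: eq_card => z;
    rewrite in_set [RHS]in_set; case zI: (z \in itv_in A x y) => //=.
  by rewrite oE // (negPf ex).
by rewrite oE // (negPf ex).
Qed.

End Duality.

Lemma sign_rev (S : pzRingType) (m n : nat) : (-1 : S) ^+ m = (-1) ^+ (m + n) * (-1) ^+ n.
Proof. by rewrite -exprD -addnA addnn -mul2n exprD exprM sqrrN expr1n expr1n mulr1. Qed.

(** The coefficients at i and n - i agree, but if i is below the size of p then n - i is beyond
    it. *)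
Lemma revp_fix_eq0 n (p : {poly int}) : ((size p).*2 <= n.+1)%N -> revp n p = p -> p = 0.
Proof.
move=> sp rp; apply/polyP => i; rewrite coef0.
have [si | si] := leqP (size p) i; first by rewrite nth_default.
rewrite -rp coef_poly; case: ltnP => // lin; rewrite nth_default //.
by move: sp si; rewrite -addnn; move: (size p) => s; lia.
Qed.

Section GpolyDegree.
Context {d : Order.disp_t} {T : finPOrderType d}.

Lemma size_gpoly (A : {set T}) : Eulerian A -> (size (gpoly A) <= (rk A).+1)%N.
Proof. by move/gpolyP/gpoly_at_size. Qed.

(** Degree less than half the rank, in terms of sizes; the boolean summand corrects for rank 0,
    where g = 1. *)
Lemma size_gpoly_half (A : {set T}) : Eulerian A ->
  ((size (gpoly A)).*2 <= (rk A == 0%N) + (rk A).+1)%N.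
Proof.
move=> /gpolyP[g0 g1]; have [rA | rA] := posnP (rk A).
  by rewrite g0 // rA size_poly1.
by have [sg _] := g1 rA; rewrite -[size _]/(size (gpoly A)) in sg *; lia.
Qed.

End GpolyDegree.

(** * The g-polynomial in the incidence algebra *)

Section Incidence.
Context {d : Order.disp_t} {T : finPOrderType d}.
Implicit Types (x y z : T).

Definition gfun x y : {poly int} := if (x <= y)%O then gpoly (itv x y) else 0.

Definition gfun_inv x y : {poly int} :=
  if (x <= y)%O then (-1) ^+ rho x y * gpoly (dual_set (itv x y)) else 0.

Definition kernel x y : {poly int} := if (x <= y)%O then ('X - 1) ^+ rho x y else 0.

Definition kernel_inv x y : {poly int} := if (x <= y)%O then (1 - 'X) ^+ rho x y else 0.

Variable r : T -> int.
Hypothesis lE : locally_Eulerian [set: T].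
Hypothesis rkT : is_rank_function r.

Lemma itv_Eulerian x y : (x <= y)%O -> Eulerian (itv x y).
Proof. by move=> xy; apply: lE; rewrite ?inE. Qed.

Lemma rank_le x y : (x <= y)%O -> r x <= r y.
Proof. by move=> /rkT; lia. Qed.

Lemma rank_lt x y : (x < y)%O -> r x < r y.
Proof.
move=> xy; have := rkT (ltW xy); have : (0 < rho x y)%N by apply: rho_in_gt0; rewrite ?inE.
by lia.
Qed.

Lemma absz_rank x y : (x <= y)%O -> `|r y - r x|%N = rho x y.
Proof. by move=> /rkT <-. Qed.

Lemma rho_add x y z : (x <= y)%O -> (y <= z)%O -> rho x z = (rho x y + rho y z)%N.
Proof.
move=> xy yz; have := rkT xy; have := rkT yz; have := rkT (le_trans xy yz); lia.
Qed.

Lemma rho_refl x : rho x x = 0%N. Proof. exact: rho_in_refl. Qed.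

Lemma rk_itv x y : rk (itv x y) = rho x y. Proof. by []. Qed.

(** The form used in convolutions: signs count from the upper end and the diagonal case is included.
    The factor (-1)^rho(x,y) converts from signs counted at the lower end. *)
Lemma Euler_sum (S : comNzRingType) x y : (x <= y)%O ->
  \sum_(z | (x <= z)%O && (z <= y)%O) (-1 : S) ^+ rho z y = (x == y)%:R.
Proof.
have [-> | xy lxy] := eqVneq x y.
  by rewrite (big_pred1 y) ?rho_refl // => z; rewrite /= eq_le andbC.
have xy' : (x < y)%O by rewrite lt_neqAle xy.
have xI : x \in itv x y by rewrite mem_itv lexx.
have yI : y \in itv x y by rewrite mem_itv lexx lxy.
have := congr1 (fun s => (-1) ^+ rho x y * s) (Eulerian_sum S (itv_Eulerian lxy) xI yI xy').
rewrite mulr0 mulr_sumr => /(etrans _); apply.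
apply: eq_big => [z | z /andP[xz zy]].
  by rewrite mem_itv_in mem_itv; case: (x <= z)%O; case: (z <= y)%O.
rewrite rho_in_itv_in // -/(rho x z) (sign_rev S _ (rho x z)).
by rewrite addnC -rho_add.
Qed.

(** The powers of t - 1 and 1 - t combine to the fixed power (t-1)^rho(x,y), leaving the alternating
    sum over [x,y]. *)
Lemma conv_kernel_inv : conv kernel kernel_inv = delta _ T.
Proof.
apply: funext2 => x y; rewrite /conv /delta.
have [xy | nxy] := boolP (x <= y)%O; last first.
  rewrite big1 => [|z _].
    by have [e | //] := eqVneq x y; rewrite e lexx in nxy.
  rewrite /kernel /kernel_inv; case: ifP => xz; last by rewrite mul0r.
  by case: ifP => zy; rewrite ?mulr0 //; case/negP: nxy; apply: le_trans zy.
transitivity (('X - 1) ^+ rho x y *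
    \sum_(z | (x <= z)%O && (z <= y)%O) (-1 : {poly int}) ^+ rho z y); last first.
  rewrite Euler_sum //; have [-> | _] := eqVneq x y; last by rewrite mulr0.
  by rewrite rho_refl mulr1.
rewrite mulr_sumr [RHS]big_mkcond; apply: eq_bigr => z _; rewrite /kernel /kernel_inv.
case xz: (x <= z)%O; last by rewrite mul0r.
case zy: (z <= y)%O; last by rewrite mulr0.
by rewrite (rho_add xz zy) exprD -mulrA; congr (_ * _); rewrite mulrC -exprNn opprB.
Qed.

Lemma graded_supp (P : T -> T -> {poly int}) :
  (forall x y, ~~ (x <= y)%O -> P x y = 0) ->
  (forall x y, (x <= y)%O -> (size (P x y) <= (rho x y).+1)%N) -> graded r r P.
Proof.
move=> P0 sP x y; have [xy | nxy] := boolP (x <= y)%O; last by left; apply: P0.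
by right; rewrite absz_rank // rank_le // sP.
Qed.

Lemma graded_gfun : graded r r gfun.
Proof.
apply: graded_supp => x y; rewrite /gfun; first by move/negPf => ->.
by move=> xy; rewrite xy; apply/size_gpoly/itv_Eulerian.
Qed.

Lemma graded_gfun_inv : graded r r gfun_inv.
Proof.
apply: graded_supp => x y; rewrite /gfun_inv; first by move/negPf => ->.
move=> xy; rewrite xy size_Msign.
apply: leq_trans (size_gpoly (Eulerian_dual (itv_Eulerian xy))) _.
by rewrite rk_dual_set.
Qed.

Lemma graded_kernel : graded r r kernel.
Proof.
apply: graded_supp => x y; rewrite /kernel; first by move/negPf => ->.
by move=> xy; rewrite xy size_Xsub1_exp.
Qed.

Lemma gfun_refl x : gfun x x = 1.
Proof.
rewrite /gfun lexx; have [g0 _] := gpolyP (itv_Eulerian (lexx x)).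
exact: g0 (rho_refl x).
Qed.

Lemma gfun_inv_refl x : gfun_inv x x = 1.
Proof.
rewrite /gfun_inv lexx rho_refl mul1r.
have [g0 _] := gpolyP (Eulerian_dual (itv_Eulerian (lexx x))).
by apply: g0; rewrite rk_dual_set; apply: rho_refl.
Qed.

Lemma bar_gfun : bar r r gfun = conv gfun kernel.
Proof.
apply: funext2 => x y; rewrite barE /conv.
have [xy | nxy] := boolP (x <= y)%O; last first.
  rewrite /gfun (negPf nxy) revp_bform bform0 big1 // => z _.
  rewrite /kernel; case: ifP => xz; last by rewrite mul0r.
  by case: ifP => zy; rewrite ?mulr0 //; case/negP: nxy; apply: le_trans zy.
have EI := itv_Eulerian xy.
rewrite /gfun xy absz_rank // (gpoly_at_revp EI (gpolyP EI)) /gsum big_mkcond.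
apply: eq_bigr => z _; rewrite mem_itv /kernel.
case xz: (x <= z)%O; last by rewrite mul0r.
case zy: (z <= y)%O; rewrite ?mulr0 //=.
have -> : down (itv x y) z = itv x z.
  rewrite (down_itv_in _ (a := x)) ?itv_in_itv_in //.
  by apply: is_minimum_itv_in; rewrite ?inE.
by rewrite !rk_itv (rho_add xz zy) addKn.
Qed.

(** The recursion for g in the dual interval: lower intervals of the dual are duals of the upper
    intervals [z,y], and splitting the sign at z turns (t-1)^rho(x,z) into (1-t)^rho(x,z). *)
Lemma bar_gfun_inv : bar r r gfun_inv = conv kernel_inv gfun_inv.
Proof.
apply: funext2 => x y; rewrite barE /conv.
have [xy | nxy] := boolP (x <= y)%O; last first.
  rewrite /gfun_inv (negPf nxy) revp_bform bform0 big1 // => z _.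
  rewrite /kernel_inv; case: ifP => xz; last by rewrite mul0r.
  by case: ifP => zy; rewrite ?mulr0 //; case/negP: nxy; apply: le_trans zy.
have EI := Eulerian_dual (itv_Eulerian xy).
rewrite /gfun_inv xy absz_rank // revp_bform bform_sign -revp_bform.
have -> : rho x y = rk (dual_set (itv x y)) by rewrite rk_dual_set.
rewrite (gpoly_at_revp EI (gpolyP EI)) /gsum big_mkcond mulr_sumr.
rewrite (reindex (fun z : T => (z : T^d))) /=; last by exists id.
apply: eq_bigr => z _; rewrite in_dual_set mem_itv /kernel_inv.
case xz: (x <= z)%O; last by rewrite mul0r mulr0.
case zy: (z <= y)%O; rewrite ?mulr0 //=.
have -> : down (dual_set (itv x y)) z = dual_set (itv z y).
  apply/setP => w; rewrite in_down !in_dual_set !mem_itv.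
  rewrite andbC andbA; congr (_ && _); apply/andP/idP => [[]//|zw].
  by split=> //; apply: le_trans zw.
rewrite !rk_dual_set !rk_itv (rho_add xz zy) addnK exprD.
rewrite -[1 - 'X]opprB [(- ('X - 1)) ^+ _]exprNn -!mulrA; congr (_ * _).
by rewrite [RHS]mulrC mulrA.
Qed.

Lemma conv_gfun_inv : conv gfun gfun_inv = delta _ T.
Proof.
have gZ : graded r r (conv gfun gfun_inv) by apply: graded_conv graded_gfun graded_gfun_inv.
have barZ : bar r r (conv gfun gfun_inv) = conv gfun gfun_inv.
  rewrite (bar_conv graded_gfun graded_gfun_inv) bar_gfun bar_gfun_inv.
  by rewrite -convA [conv kernel _]convA conv_kernel_inv conv_deltal.
have Z0 x y z : ~~ ((x <= z)%O && (z <= y)%O) -> gfun x z * gfun_inv z y = 0.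
  rewrite /gfun /gfun_inv; case: (x <= z)%O => [/negPf /= -> |]; by rewrite ?mulr0 ?mul0r.
apply: funext2 => x y; rewrite /delta; have [-> | xy] := eqVneq x y.
  rewrite /conv (bigD1 y) //= gfun_refl gfun_inv_refl mulr1 big1 ?addr0 // => z zy.
  by apply: Z0; rewrite -eq_le eq_sym.
have [lxy | nxy] := boolP (x <= y)%O; last first.
  rewrite /conv big1 // => z _; apply: Z0; apply: contra nxy => /andP[]; exact: le_trans.
apply: (@revp_fix_eq0 (rho x y)).
  suff: (size (conv gfun gfun_inv x y) <= uphalf (rho x y))%N.
    by rewrite -mul2n; move: (size _) => s; lia.
  apply: (leq_trans (size_sum _ _ _)); apply/bigmax_leqP => z _.
  have [/andP[xz zy] | /Z0 ->] := boolP ((x <= z)%O && (z <= y)%O); last first.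
    by rewrite size_poly0.
  rewrite /gfun /gfun_inv xz zy mulrCA size_Msign.
  apply: (leq_trans (size_polyMleq _ _)).
  have := size_gpoly_half (itv_Eulerian xz).
  have := size_gpoly_half (Eulerian_dual (itv_Eulerian zy)); rewrite rk_dual_set.
  rewrite !rk_itv (rho_add xz zy).
  (* The total rank is positive, so at most one factor has rank 0 and needs the correction in
     [size_gpoly_half]. *)
  have rxy : (0 < rho x z + rho z y)%N.
    by rewrite -rho_add //; apply: rho_in_gt0; rewrite ?inE // lt_neqAle xy.
  move: (size _) (size _) => a b; lia.
by rewrite -absz_rank // -barE barZ.
Qed.

Lemma conv_inv_gfun : conv gfun_inv gfun = delta _ T.
Proof. exact/conv_inverse_comm/conv_gfun_inv. Qed.

Lemma bar_kernel : bar r r kernel = kernel_inv.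
Proof.
apply: funext2 => x y; rewrite barE revp_bform /kernel /kernel_inv.
case: ifP => xy; last by rewrite bform0.
by rewrite absz_rank // bform_Xsub1_exp.
Qed.

End Incidence.

(** * Subdivisions *)

Section SubdivisionFunctions.
Context {dG dB : Order.disp_t} {G : finPOrderType dG} {B : finPOrderType dB}.
Variables (rG : G -> int) (rB : B -> int) (sigma : G -> B).

Definition hfun (y : G) (x : B) : {poly int} :=
  if (sigma y <= x)%O then hpoly (fiber_above sigma y x) else 0.

Definition lfun : G -> B -> {poly int} := conv hfun gfun_inv.

(** This is K of the outline, and [mdelta] is D. The function [mkernel_inv] is the bar of K; K
    itself is rectangular and is not being inverted. *)
Definition mkernel (y : G) (x : B) : {poly int} :=
  if (sigma y <= x)%O then ('X - 1) ^+ `|rB x - rG y|%N else 0.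

Definition mkernel_inv (y : G) (x : B) : {poly int} :=
  if (sigma y <= x)%O then (1 - 'X) ^+ `|rB x - rG y|%N else 0.

Definition mdelta (y : G) (x : B) : {poly int} :=
  if sigma y == x then ('X - 1) ^+ `|rB x - rG y|%N else 0.

(** A strong formal subdivision without surjectivity and the alternating sum
    condition; unlike the latter, these properties clearly pass to compositions. *)
Definition weak_subdivision : Prop :=
  [/\ {homo sigma : y y' / (y <= y')%O},
      forall y, rG y <= rB (sigma y) &
      forall y x, (sigma y <= x)%O ->
        exists y', [/\ (y <= y')%O, sigma y' = x & rG y' = rB x]].

Lemma strong_weak_subdivision : strong_formal_subdivision rG rB sigma -> weak_subdivision.
Proof. by case. Qed.

Hypothesis lG : locally_Eulerian [set: G].
Hypothesis lB : locally_Eulerian [set: B].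
Hypothesis rkG : is_rank_function rG.
Hypothesis rkB : is_rank_function rB.
Hypothesis weak : weak_subdivision.

Lemma rank_sigma_le y x : (sigma y <= x)%O -> rG y <= rB x.
Proof. by case: weak => _ le_r _ /(rank_le rkB); apply: le_trans. Qed.

Lemma sigma_le y z x : (y <= z)%O -> (sigma z <= x)%O -> (sigma y <= x)%O.
Proof. by case: weak => homo_s _ _ /homo_s; apply: le_trans. Qed.

(** The lifting condition yields z over x with rG z = rB x, and [y,z] lies in the fiber: this bounds
    the rank from below. From above, [rG] is injective on a chain with values between rG y and rB
    x. *)
Lemma rk_fiber_above y x : (sigma y <= x)%O ->
  rk (fiber_above sigma y x) = `|rB x - rG y|%N.
Proof.
move=> yx; apply/eqP; rewrite eqn_leq; apply/andP; split; last first.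
  have [_ _ lift] := weak; have [z [yz zx rz]] := lift y x yx.
  rewrite -rz (absz_rank rkG) //; apply: rkS; apply/subsetP => w.
  rewrite mem_itv inE => /andP[-> wz]; rewrite -zx /=.
  by have [homo_s _ _] := weak; apply: homo_s.
have [C /andP[/subsetP sC /is_chainP cC] <-] := rk_exists (fiber_above sigma y x).
(* On the chain the offset stays within the bound, so [inord] never falls back to its default
   there. *)
pose f z : 'I_`|rB x - rG y|.+1 := inord `|rG z - rG y|.
have rC z : z \in C -> rG y <= rG z <= rB x.
  by move/sC; rewrite inE => /andP[yz zx]; rewrite (rank_le rkG yz) rank_sigma_le.
suff inj_f : {in C &, injective f}.
  by have := max_card (mem (f @: C)); rewrite (card_in_imset inj_f) card_ord; lia.
move=> z w zC wC /(congr1 val) /=; have := rC z zC; have := rC w wC => rw rz.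
rewrite !inordK; try lia; move=> e; have {}e : rG z = rG w by lia.
apply/eqP; apply: contraT => zw.
have /orP[] := cC z w zC wC; rewrite le_eqVlt ?(negPf zw) ?[w == z]eq_sym ?(negPf zw) /=;
  by move/(rank_lt rkG); rewrite e ltxx.
Qed.

Lemma size_mkernel y x : (size (mkernel y x) <= `|rB x - rG y|%N.+1)%N.
Proof. by rewrite /mkernel; case: ifP => _; rewrite ?size_poly0 // size_Xsub1_exp. Qed.

Lemma graded_mkernel : graded rG rB mkernel.
Proof.
move=> y x; have [yx | nyx] := boolP (sigma y <= x)%O.
  by right; rewrite rank_sigma_le // size_mkernel.
by left; rewrite /mkernel (negPf nyx).
Qed.

Lemma bar_mkernel : bar rG rB mkernel = mkernel_inv.
Proof.
apply: funext2 => y x; rewrite barE revp_bform /mkernel /mkernel_inv.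
by case: ifP => yx; rewrite ?bform0 // bform_Xsub1_exp.
Qed.

(** The definition of h as a convolution: the lower intervals of the fiber above y are the intervals
    [y,z] of G, and ranks of fibers are rank differences. *)
Lemma hfun_bar : hfun = bar rG rB (conv gfun mkernel).
Proof.
apply: funext2 => y x; rewrite barE /hfun /conv.
have [yx | nyx] := boolP (sigma y <= x)%O; last first.
  rewrite big1 ?revp_bform ?bform0 // => z _; rewrite /gfun /mkernel.
  case: ifP => yz; last by rewrite mul0r.
  by case: ifP => zx; rewrite ?mulr0 //; case/negP: nyx; apply: sigma_le zx.
rewrite /hpoly rk_fiber_above //; congr revp; rewrite /gsum big_mkcond.
apply: eq_bigr => z _; rewrite inE /gfun /mkernel.
case yz: (y <= z)%O; last by rewrite mul0r.
case zx: (sigma z <= x)%O; last by rewrite mulr0.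
have -> : down (fiber_above sigma y x) z = itv y z.
  apply/setP => w; rewrite mem_itv in_down inE -andbA; congr (_ && _).
  by apply/andP/idP => [[]//|wz]; split=> //; apply: sigma_le zx.
rewrite rk_itv rk_fiber_above //= -(absz_rank rkG yz).
have := rank_le rkG yz; have := rank_sigma_le zx => ? ?.
by congr (_ * _ ^+ _); lia.
Qed.

Lemma bar_hfun : bar rG rB hfun = conv gfun mkernel.
Proof.
by rewrite hfun_bar (barK (graded_conv (graded_gfun lG rkG) graded_mkernel)).
Qed.

Lemma graded_hfun : graded rG rB hfun.
Proof.
by rewrite hfun_bar; apply/graded_bar/(graded_conv (graded_gfun lG rkG) graded_mkernel).
Qed.

Lemma graded_lfun : graded rG rB lfun.
Proof. exact: graded_conv graded_hfun (graded_gfun_inv lB rkB). Qed.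

Lemma conv_lfun_gfun : conv lfun gfun = hfun.
Proof. by rewrite /lfun -convA (conv_inv_gfun lB rkB) conv_deltar. Qed.

(** As for [kernel], the powers combine to a fixed one; the alternating sum over [sigma y, x]
    vanishes unless sigma y = x. *)
Lemma conv_mkernel_inv : conv mkernel kernel_inv = mdelta.
Proof.
apply: funext2 => y x; rewrite /conv /mdelta.
have [yx | nyx] := boolP (sigma y <= x)%O; last first.
  rewrite big1 => [|z _].
    by have [e | //] := eqVneq (sigma y) x; rewrite e lexx in nyx.
  rewrite /mkernel /kernel_inv; case: ifP => yz; last by rewrite mul0r.
  by case: ifP => zx; rewrite ?mulr0 //; case/negP: nyx; apply: le_trans zx.
transitivity (('X - 1) ^+ `|rB x - rG y|%N *
    \sum_(z | (sigma y <= z)%O && (z <= x)%O) (-1 : {poly int}) ^+ rho z x); last first.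
  by rewrite (Euler_sum lB rkB) //; case: eqP => _; rewrite ?mulr1 ?mulr0.
rewrite mulr_sumr [RHS]big_mkcond; apply: eq_bigr => z _; rewrite /mkernel /kernel_inv.
case yz: (sigma y <= z)%O; last by rewrite mul0r.
case zx: (z <= x)%O; last by rewrite mulr0.
have := rank_sigma_le yz; have := rank_le rkB zx; rewrite -(absz_rank rkB zx) => ? ?.
have -> : `|rB x - rG y|%N = (`|rB z - rG y| + `|rB x - rB z|)%N by lia.
by rewrite exprD -mulrA; congr (_ * _); rewrite mulrC -exprNn opprB.
Qed.

Lemma lfun_supp y x : ~~ (sigma y <= x)%O -> lfun y x = 0.
Proof.
move=> nyx; rewrite /lfun /conv big1 // => z _; rewrite /hfun /gfun_inv.
case: ifP => yz; last by rewrite mul0r.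
by case: ifP => zx; rewrite ?mulr0 //; case/negP: nyx; apply: le_trans zx.
Qed.

Lemma local_hE x y : local_h sigma x y = lfun y x.
Proof.
rewrite /local_h; case: ifPn => [yx | /lfun_supp -> //].
rewrite /lfun /conv big_mkcond; apply: eq_bigr => z _; rewrite mem_itv /hfun /gfun_inv.
case yz: (sigma y <= z)%O; last by rewrite mul0r.
by case zx: (z <= x)%O; rewrite ?mulr0 // mulrA.
Qed.

Lemma mixed_hE x y : mixed_h rG rB sigma x y =
  conv (gform rG rB varu varv lfun) (fun x' x => ev1 (varu * varv) (gfun x' x)) y x.
Proof.
rewrite /mixed_h /conv /gform; case: ifPn => [yx | nyx].
  rewrite big_mkcond; apply: eq_bigr => z _; rewrite mem_itv local_hE /gfun.
  case: ifPn => [/andP[yz zx] | nyzx]; first by rewrite zx.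
  case zx: (z <= x)%O; last by rewrite rmorph0 mulr0.
  by rewrite lfun_supp ?bform0 ?mul0r //; rewrite zx andbT in nyzx.
rewrite big1 // => z _; rewrite /gfun; case zx: (z <= x)%O; last by rewrite rmorph0 mulr0.
rewrite lfun_supp ?bform0 ?mul0r //; apply: contra nyx => yz; exact: le_trans zx.
Qed.

(** * Symmetry of the local h-polynomial *)

Section Strong.
Hypothesis strong : strong_formal_subdivision rG rB sigma.

(** Here the alternating sum condition enters. Grouping the elements above y by their image w, each
    group sums to (-1)^rho(w,x); the Eulerian property of B then handles the sum over w. *)
Lemma conv_kernel_mkernel_inv : conv kernel mkernel_inv = mdelta.
Proof.
apply: funext2 => y x; rewrite /conv /mdelta.
have [yx | nyx] := boolP (sigma y <= x)%O; last first.
  rewrite big1 => [|z _].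
    by have [e | //] := eqVneq (sigma y) x; rewrite e lexx in nyx.
  rewrite /kernel /mkernel_inv; case: ifP => yz; last by rewrite mul0r.
  by case: ifP => zx; rewrite ?mulr0 //; case/negP: nyx; apply: sigma_le zx.
transitivity (('X - 1) ^+ `|rB x - rG y|%N *
    \sum_(z | (y <= z)%O && (sigma z <= x)%O) (-1 : {poly int}) ^+ `|rB x - rG z|%N).
  rewrite mulr_sumr [RHS]big_mkcond; apply: eq_bigr => z _; rewrite /kernel /mkernel_inv.
  case yz: (y <= z)%O; last by rewrite mul0r.
  case zx: (sigma z <= x)%O; last by rewrite mulr0.
  have := rank_sigma_le zx; have := rank_le rkG yz; rewrite -(absz_rank rkG yz) => ? ?.
  have -> : `|rB x - rG y|%N = (`|rG z - rG y| + `|rB x - rG z|)%N by lia.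
  by rewrite exprD -mulrA; congr (_ * _); rewrite mulrC -exprNn opprB.
transitivity (('X - 1 : {poly int}) ^+ `|rB x - rG y|%N * (sigma y == x)%:R); last first.
  by case: eqP => _; rewrite ?mulr1 ?mulr0.
congr (_ * _); rewrite -(Euler_sum lB rkB _ yx).
rewrite (partition_big sigma (fun w => (sigma y <= w)%O && (w <= x)%O)) /=; last first.
  by move=> z /andP[yz ->]; rewrite andbT; case: strong => homo_s _ _ _ _; apply: homo_s.
apply: eq_bigr => w /andP[yw wx].
have [_ _ _ _ alt] := strong; rewrite -[RHS]mulr1 -[X in _ * X]/(1%:~R) -(alt y w yw).
rewrite rmorph_sum mulr_sumr; apply: eq_big => [z | z /andP[/andP[yz zx] /eqP zw]].
  by case: eqP => [-> | _]; rewrite ?andbF // wx !andbT.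
rewrite -zw in wx *; have := rank_sigma_le (lexx (sigma z)); have := rank_le rkB wx => ? ?.
(* The subdivision condition has an integer exponent; it is nonnegative, so the sign becomes a
   natural power that can be merged with (-1)^rho(w,x). *)
have -> : rB (sigma z) - rG z = `|rB (sigma z) - rG z|%N :> int by lia.
rewrite -exprnP rmorphXn rmorphN1 -exprD -(absz_rank rkB wx); congr (_ ^+ _); lia.
Qed.

(** With g, k for G and k_B for B: (bar H) k_B^-1 = g K k_B^-1 = g D = g k (bar K) = (bar g)(bar K)
    = bar (g K) = H. *)
Lemma hfunE : hfun = conv (bar rG rB hfun) kernel_inv.
Proof.
rewrite bar_hfun -convA conv_mkernel_inv -conv_kernel_mkernel_inv convA.
rewrite -(bar_gfun lG rkG) -bar_mkernel hfun_bar.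
by rewrite (bar_conv (graded_gfun lG rkG) graded_mkernel).
Qed.

Lemma bar_lfun : bar rG rB lfun = lfun.
Proof.
rewrite /lfun (bar_conv graded_hfun (graded_gfun_inv lB rkB)) (bar_gfun_inv lB rkB).
by rewrite convA -hfunE.
Qed.

End Strong.

End SubdivisionFunctions.

(** * Composition of subdivisions *)

Section Composition.
Context {dO dG dB : Order.disp_t} {O : finPOrderType dO}.
Context {G : finPOrderType dG} {B : finPOrderType dB}.
Variables (rO : O -> int) (rG : G -> int) (rB : B -> int).
Variables (tau : O -> G) (sigma : G -> B).
Hypotheses (lO : locally_Eulerian [set: O]) (lG : locally_Eulerian [set: G]).
Hypothesis lB : locally_Eulerian [set: B].
Hypotheses (rkO : is_rank_function rO) (rkG : is_rank_function rG).
Hypothesis rkB : is_rank_function rB.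
Hypothesis weak_tau : weak_subdivision rO rG tau.
Hypothesis weak_sigma : weak_subdivision rG rB sigma.

Lemma weak_subdivision_comp : weak_subdivision rO rB (sigma \o tau).
Proof.
have [homo_t rt lift_t] := weak_tau; have [homo_s rs lift_s] := weak_sigma.
split=> [z z' /homo_t/homo_s //|z|z x zx].
  exact: le_trans (rt z) (rs (tau z)).
have [y [zy yx ry]] := lift_s _ _ zx; have [z' [zz' zy' rz]] := lift_t _ _ zy.
by exists z'; rewrite /= zy' yx rz ry.
Qed.

Lemma conv_mdelta_mkernel :
  conv (mdelta rO rG tau) (mkernel rG rB sigma) = mkernel rO rB (sigma \o tau).
Proof.
apply: funext2 => z x; rewrite /conv (bigD1 (tau z)) //= big1 ?addr0 => [|y /negPf yz].
  rewrite /mdelta eqxx /mkernel /=; case: ifP => zx; last by rewrite mulr0.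
  have := rank_sigma_le rkB weak_sigma zx.
  have := rank_sigma_le rkG weak_tau (lexx (tau z)) => ? ?.
  by rewrite -exprD; congr (_ ^+ _); lia.
by rewrite /mdelta eq_sym yz mul0r.
Qed.

(** The bar of the right side is g_O K_tau k_G^-1 g_G^-1 g_G K_sigma = g_O D_tau K_sigma. Since
    D_tau is supported on the graph of tau, this is g_O times the K of the composite, whose bar is
    the left side. *)
Lemma hfun_comp : hfun (sigma \o tau) = conv (lfun tau) (hfun sigma).
Proof.
have weak := weak_subdivision_comp.
have gl := graded_lfun lO lG rkO rkG weak_tau.
have gh := graded_hfun lG rkG rkB weak_sigma.
rewrite -(barK (graded_conv gl gh)) (bar_conv gl gh) (bar_hfun lG rkG rkB weak_sigma).
rewrite /lfun (bar_conv (graded_hfun lO rkO rkG weak_tau) (graded_gfun_inv lG rkG)).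
rewrite (bar_hfun lO rkO rkG weak_tau) (bar_gfun_inv lG rkG).
rewrite -!convA [conv gfun_inv (conv _ _)]convA (conv_inv_gfun lG rkG) conv_deltal.
rewrite [conv (mkernel _ _ _) (conv _ _)]convA (conv_mkernel_inv lG rkG weak_tau).
by rewrite conv_mdelta_mkernel (hfun_bar rkO rkB weak).
Qed.

Lemma lfun_comp : lfun (sigma \o tau) = conv (lfun tau) (lfun sigma).
Proof. by rewrite {1}/lfun hfun_comp -convA. Qed.

End Composition.

(** * The mixed h-polynomial *)

Section BivariateDegree.
Implicit Types (p q : {poly {poly int}}).

Definition tdeg_lt m p : Prop := forall i j : nat, (m <= i + j)%N -> p`_i`_j = 0.

Lemma coef_homog m (p : {poly int}) (i j : nat) :
  (homog m p)`_i`_j = if (i + j == m)%N then p`_i else 0.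
Proof.
rewrite /homog coef_sum coef_sum.
have mono (k : 'I_m.+1) : ((p`_k)%:~R * varu ^+ k * varv ^+ (m - k))`_i`_j =
    if (i == k) && (j == m - k)%N then p`_k else 0.
  rewrite mulrAC /varu /varv -rmorphXn -(rmorph_int polyC) -rmorphM /= coefCM coefXn.
  case: eqP => _; last by rewrite mulr0 coef0.
  rewrite mulr1 -(rmorph_int polyC) coefCM coefXn intz.
  by case: eqP => _; rewrite ?mulr1 ?mulr0.
under eq_bigr do rewrite mono.
case: eqP => ijm; last first.
  rewrite big1 // => k _; case: ifP => // /andP[/eqP ? /eqP ?].
  by have := ltn_ord k; lia.
have im : (i < m.+1)%N by lia.
rewrite (bigD1 (Ordinal im)) //= eqxx big1 ?addr0 => [|k ki].
  by have -> : (j == m - i)%N by apply/eqP; lia.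
by case: ifP => // /andP[/eqP e _]; case/eqP: ki; apply: val_inj.
Qed.

Lemma tdeg_lt_homog m (p : {poly int}) : tdeg_lt m.+1 (homog m p).
Proof. by move=> i j ij; rewrite coef_homog; case: eqP => // ?; lia. Qed.

(** A weak bound times a strict one stays strict; used for a form of degree m times a g(uv) of total
    degree below n. *)
Lemma tdeg_ltM m n p q : tdeg_lt m.+1 p -> tdeg_lt n q -> tdeg_lt (m + n) (p * q).
Proof.
move=> dp dq i j ij; rewrite coefM coef_sum big1 // => a _.
rewrite coefM big1 // => b _; have := ltn_ord a; have := ltn_ord b => ? ?.
have [ab | ab] := leqP m.+1 (a + b); first by rewrite dp ?mul0r.
by rewrite [X in _ * X]dq ?mulr0 //; lia.
Qed.

Lemma tdeg_lt_sum m (I : Type) (s : seq I) (P : pred I) (F : I -> {poly {poly int}}) :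
  (forall i, P i -> tdeg_lt m (F i)) -> tdeg_lt m (\sum_(i <- s | P i) F i).
Proof. by move=> dF i j ij; rewrite !coef_sum big1 // => k Pk; apply: dF. Qed.

(** Substituting uv doubles degrees, so degree below n/2 becomes total degree below n. *)
Lemma tdeg_lt_ev1 n (p : {poly int}) : ((size p).*2 <= n.+1)%N ->
  tdeg_lt n (ev1 (varu * varv) p).
Proof.
rewrite -addnn => sp; rewrite -eval1E (eval1_wide _ (leqnn _)).
apply: tdeg_lt_sum => k _ i j ij; have := ltn_ord k => kp.
rewrite exprMn mulrA mulrAC /varu /varv -rmorphXn -(rmorph_int polyC) -rmorphM /=.
rewrite coefCM coefXn.
have [ik | _] := eqVneq i k; last by rewrite mulr0 coef0.
rewrite mulr1 -(rmorph_int polyC) coefCM coefXn.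
have [jk | _] := eqVneq j k; last by rewrite mulr0.
lia.
Qed.

End BivariateDegree.

Lemma homog0 m : homog m 0 = 0.
Proof. exact: bform0. Qed.

Lemma bform_inv (F : fieldType) (u v : F) m p : u != 0 -> v != 0 ->
  (u * v) ^+ m * bform u^-1 v^-1 m p = bform v u m p.
Proof.
move=> u0 v0; rewrite /bform mulr_sumr; apply: eq_bigr => i _.
have im : (i <= m)%N by rewrite -ltnS.
rewrite -[in (u * v) ^+ m](subnK im) exprD !exprMn !exprVn.
by field; rewrite !expf_neq0.
Qed.

Lemma ev1_0 (S : comNzRingType) p : ev1 (0 : S) p = (p`_0)%:~R.
Proof.
rewrite -eval1E (eval1_bform 0 (leqnSn (size p))) /bform big_ord_recl big1 ?addr0 => [|i _].
  by rewrite expr0 expr1n !mulr1.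
by rewrite expr0n mulr0 mul0r.
Qed.

Lemma bform_0l (S : comNzRingType) (b : S) m p : bform 0 b m p = ev1 0 p * b ^+ m.
Proof.
rewrite ev1_0 /bform big_ord_recl big1 ?addr0 => [|i _].
  by rewrite expr0 subn0 mulr1.
by rewrite expr0n mulr0 mul0r.
Qed.

Lemma ev1_X (p : {poly int}) : ev1 'X p = p.
Proof.
rewrite -[RHS]comp_polyXr -eval1E /eval1 /comp_poly; congr _.[_].
by apply: eq_map_poly => c; rewrite -[c in RHS]intz rmorph_int.
Qed.

(** * Symmetry, specialization and inversion of the mixed h-polynomial *)

Section MixedH.
Context {dG dB : Order.disp_t} {G : finPOrderType dG} {B : finPOrderType dB}.
Variables (rG : G -> int) (rB : B -> int) (sigma : G -> B).
Hypothesis lG : locally_Eulerian [set: G].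
Hypothesis lB : locally_Eulerian [set: B].
Hypothesis rkG : is_rank_function rG.
Hypothesis rkB : is_rank_function rB.
Hypothesis strong : strong_formal_subdivision rG rB sigma.

Let weak := strong_weak_subdivision strong.
Let glfun := graded_lfun lG lB rkG rkB weak.

(** L is fixed by [bar], and [bar] exchanges the variables of the homogenization. *)
Lemma gform_lfunC (S : comNzRingType) (a b : S) :
  gform rG rB a b (lfun sigma) = gform rG rB b a (lfun sigma).
Proof. by rewrite -{1}(bar_lfun lG lB rkG rkB weak strong) gform_bar. Qed.

Lemma ev2_mixed_h (S : comNzRingType) (a b : S) x y :
  eval2 (mixed_h rG rB sigma x y) a b =
  conv (gform rG rB a b (lfun sigma)) (fun x' x => ev1 (a * b) (gfun x' x)) y x.
Proof.
rewrite eval2E mixed_hE rmorph_conv; congr conv; apply: funext2 => i j.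
  by rewrite /gform rmorph_bform ev2_varu ev2_varv.
by rewrite rmorph_ev1 rmorphM ev2_varu ev2_varv.
Qed.

Lemma mixed_h_swap x y :
  eval2 (mixed_h rG rB sigma x y) varv varu = mixed_h rG rB sigma x y.
Proof. by rewrite ev2_mixed_h gform_lfunC mulrC mixed_hE. Qed.

(** At v = 1 the homogenized L becomes L and g(uv) becomes g, so the convolution is L g = H. *)
Lemma mixed_h_v1 x y : eval2 (mixed_h rG rB sigma x y) 'X 1 = hfun sigma y x.
Proof.
rewrite ev2_mixed_h -(conv_lfun_gfun sigma lB rkB) mulr1; congr conv; apply: funext2 => i j.
  rewrite /gform; have [-> | [_ sl]] := glfun i j; first by rewrite bform0.
  by rewrite -(eval1_bform _ sl) eval1E ev1_X.
exact: ev1_X.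
Qed.

(** Inversion exchanges u and v in the homogenized L, which is symmetric, and replaces g by bar g =
    g k, where k evaluates at uv to powers of uv - 1. *)
Lemma mixed_h_inv (F : fieldType) (u v : F) x y : u != 0 -> v != 0 ->
  (u * v) ^+ `|rB x - rG y|%N * eval2 (mixed_h rG rB sigma x y) u^-1 v^-1 =
  \sum_(x' | (x' <= x)%O) eval2 (mixed_h rG rB sigma x' y) u v * (u * v - 1) ^+ rho x' x.
Proof.
move=> u0 v0; have uv0 : u * v != 0 by rewrite mulf_neq0.
transitivity (conv (gform rG rB u v (lfun sigma))
    (fun x' x => ev1 (u * v) (bar rB rB gfun x' x)) y x).
  rewrite ev2_mixed_h [in RHS]gform_lfunC /conv mulr_sumr; apply: eq_bigr => x' _.
  rewrite /gform barE; have [-> | [yx' _]] := glfun y x'.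
    by rewrite !bform0 !mul0r mulr0.
  have [-> | [x'x sg]] := graded_gfun lB rkB x' x.
    by rewrite revp_bform bform0 !rmorph0 !mulr0.
  rewrite -[ev1 _ (revp _ _)]eval1E (revpE sg uv0) -invfM.
  (* The power of uv splits at x': one part clears the denominators of L, the other those of g. *)
  have -> : `|rB x - rG y|%N = (`|rB x' - rG y| + `|rB x - rB x'|)%N by lia.
  by rewrite exprD mulrACA bform_inv // invfM [v^-1 / u]mulrC -invfM.
rewrite (bar_gfun lB rkB).
transitivity (conv (conv (gform rG rB u v (lfun sigma))
      (fun x' x => ev1 (u * v) (gfun x' x)))
    (fun x' x => ev1 (u * v) (kernel x' x)) y x).
  rewrite -convA; congr conv; apply: funext2 => i j; exact: rmorph_conv.
rewrite /conv [RHS]big_mkcond; apply: eq_bigr => x' _.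
rewrite ev2_mixed_h /kernel /conv; case: ifP => _; last by rewrite rmorph0 mulr0.
by rewrite rmorphXn rmorphB rmorph1 ev1_polyX.
Qed.

(** Convolution with the inverse of g, evaluated at uv, undoes the convolution with g(uv). *)
Lemma mixed_h_local_h x y :
  gform rG rB varu varv (lfun sigma) y x =
  \sum_(x' | (x' <= x)%O) mixed_h rG rB sigma x' y * (-1) ^+ rho x' x
     * eval1 (gpoly (dual_set (itv x' x))) (varu * varv).
Proof.
set V := gform _ _ _ _ _.
have -> : V = conv (conv V (fun x' x => ev1 (varu * varv) (gfun x' x)))
    (fun x' x => ev1 (varu * varv) (gfun_inv x' x)).
  rewrite -convA -[LHS]conv_deltar; congr conv; apply: funext2 => i j.
  rewrite -(rmorph_conv (ev1 (varu * varv))) (conv_gfun_inv lB rkB) /delta.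
  by rewrite rmorph_nat.
rewrite {1}/conv [RHS]big_mkcond; apply: eq_bigr => x' _.
rewrite -mixed_hE /gfun_inv; case: ifP => _; last by rewrite rmorph0 mulr0.
by rewrite rmorphM rmorphXn rmorphN1 mulrA.
Qed.

End MixedH.

(** * Constant terms of g, H and L *)

Section ConstantTerms.
Context {dB : Order.disp_t} {B : finPOrderType dB}.
Variable (rB : B -> int).
Hypothesis lB : locally_Eulerian [set: B].
Hypothesis rkB : is_rank_function rB.

(** The constant term of bar g is the coefficient of g in degree rho(x,y), which off the diagonal
    exceeds the degree of g. *)
Lemma ev1_0_bar_gfun (x y : B) : ev1 0 (bar rB rB gfun x y) = delta int B x y.
Proof.
rewrite ev1_0 intz barE coef_poly subn0 /= /delta; have [-> | xy] := eqVneq x y.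
  by rewrite subrr /= (gfun_refl lB) coef1.
rewrite /gfun; case: ifP => lxy; last by rewrite coef0.
have := size_gpoly_half (itv_Eulerian lB lxy); rewrite rk_itv (absz_rank rkB lxy) => s.
rewrite nth_default //; have : (0 < rho x y)%N.
  by apply: rho_in_gt0; rewrite ?inE // lt_neqAle xy.
by move: s; rewrite -addnn; case: (rho x y) => [|k]; move: (size _) => s /=; lia.
Qed.

(** g = bar (g k) = (bar g)(bar k): the constant terms of bar g form the identity, and those of bar
    k are 1 on all intervals. *)
Lemma ev1_0_gfun (x y : B) : ev1 0 (gfun x y) = (x <= y)%O%:R :> int.
Proof.
rewrite -(barK (graded_gfun lB rkB)) (bar_gfun lB rkB).
rewrite (bar_conv (graded_gfun lB rkB) (graded_kernel rkB)) (bar_kernel rkB) rmorph_conv.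
have -> : (fun x y => ev1 0 (bar rB rB gfun x y)) = delta int B.
  by apply: funext2 => i j; apply: ev1_0_bar_gfun.
rewrite conv_deltal /kernel_inv; case: ifP => _; last by rewrite rmorph0.
by rewrite rmorphXn rmorphB rmorph1 ev1_polyX subr0 expr1n.
Qed.

End ConstantTerms.

Section ConstantTermsOfSubdivisions.
Context {dG dB : Order.disp_t} {G : finPOrderType dG} {B : finPOrderType dB}.
Variables (rG : G -> int) (rB : B -> int) (sigma : G -> B).
Hypothesis lG : locally_Eulerian [set: G].
Hypothesis lB : locally_Eulerian [set: B].
Hypothesis rkG : is_rank_function rG.
Hypothesis rkB : is_rank_function rB.
Hypothesis strong : strong_formal_subdivision rG rB sigma.

Let weak := strong_weak_subdivision strong.

Lemma ev1_0_hfun y x : ev1 0 (hfun sigma y x) = (sigma y <= x)%O%:R :> int.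
Proof.
rewrite (hfun_bar rkG rkB weak).
rewrite (bar_conv (graded_gfun lG rkG) (graded_mkernel rkB weak)) bar_mkernel rmorph_conv.
have -> : (fun x y => ev1 0 (bar rG rG gfun x y)) = delta int G.
  by apply: funext2 => i j; apply: ev1_0_bar_gfun.
rewrite conv_deltal /mkernel_inv; case: ifP => _; last by rewrite rmorph0.
by rewrite rmorphXn rmorphB rmorph1 ev1_polyX subr0 expr1n.
Qed.

(** The constant terms of H are the matrix of sigma times the zeta function of B, which is also the
    constant term of g_B; multiplying by g_B^-1 leaves the matrix of sigma. *)
Lemma ev1_0_lfun y x : ev1 0 (lfun sigma y x) = (sigma y == x)%:R :> int.
Proof.
rewrite /lfun rmorph_conv.
have -> : (fun y x => ev1 0 (hfun sigma y x)) =
    conv (fun y x => (sigma y == x)%:R) (fun y x => ev1 0 (gfun y x)) :> (G -> B -> int).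
  apply: funext2 => i j; rewrite ev1_0_hfun /conv (bigD1 (sigma i)) // eqxx mul1r.
  rewrite (ev1_0_gfun lB rkB) big1 => [/=|z /negPf zi].
    by rewrite addr0.
  by rewrite eq_sym zi mul0r.
rewrite -convA; have -> : conv (fun y x => ev1 0 (gfun y x))
    (fun y x => ev1 0 (gfun_inv y x)) = delta int B.
  by apply: funext2 => i j; rewrite -rmorph_conv (conv_gfun_inv lB rkB) rmorph_nat.
by rewrite conv_deltar.
Qed.

(** At u = 0 only constant terms survive, and that of L restricts the sum to x' = sigma y. *)
Lemma mixed_h_u0 y x : (sigma y <= x)%O ->
  eval2 (mixed_h rG rB sigma x y) 0 'X = 'X^`|rB (sigma y) - rG y|%N :> {poly int}.
Proof.
move=> yx; rewrite ev2_mixed_h.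
have e0 p : ev1 (0 : {poly int}) p = (ev1 (0 : int) p)%:P.
  by rewrite !ev1_0 rmorph_int.
rewrite /conv (bigD1 (sigma y)) // big1 => [|z /negPf zy].
  rewrite [LHS]addr0 /gform bform_0l mul0r.
  by rewrite !e0 ev1_0_lfun eqxx (ev1_0_gfun lB rkB) yx mul1r mulr1.
by rewrite /gform bform_0l e0 ev1_0_lfun eq_sym zy !mul0r.
Qed.

End ConstantTermsOfSubdivisions.

(** * Terms of top total degree *)

Section TopDegree.
Context {dG dB : Order.disp_t} {G : finPOrderType dG} {B : finPOrderType dB}.
Variables (rG : G -> int) (rB : B -> int) (sigma : G -> B).
Hypothesis lB : locally_Eulerian [set: B].
Hypothesis rkB : is_rank_function rB.
Hypothesis weak : weak_subdivision rG rB sigma.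

(** The term x' = x is the homogenized L, since g([x,x]) = 1. For x' < x the degree of g([x',x]) is
    below half of the rank, so the total degree drops. *)
Lemma mixed_h_top x y : exists2 e : {poly {poly int}},
  tdeg_lt `|rB x - rG y|%N e &
  mixed_h rG rB sigma x y = homog `|rB x - rG y|%N (lfun sigma y x) + e.
Proof.
rewrite mixed_hE /conv (bigD1 x) //.
rewrite (gfun_refl lB) rmorph1 mulr1; eexists; last by [].
apply: tdeg_lt_sum => z /andP[_ zx]; have [yz | nyz] := boolP (sigma y <= z)%O; last first.
  by move=> i j _; rewrite /gform lfun_supp // bform0 mul0r !coef0.
have [lzx | nzx] := boolP (z <= x)%O; last first.
  by move=> i j _; rewrite /gfun (negPf nzx) rmorph0 mulr0 !coef0.
have -> : `|rB x - rG y|%N = (`|rB z - rG y| + rho z x)%N.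
  rewrite -(absz_rank rkB lzx).
  by have := rank_le rkB lzx; have := rank_sigma_le rkB weak yz; lia.
apply: tdeg_ltM; first exact: tdeg_lt_homog.
apply: tdeg_lt_ev1; rewrite /gfun lzx.
have := size_gpoly_half (itv_Eulerian lB lzx); rewrite rk_itv.
have : (0 < rho z x)%N by apply: rho_in_gt0; rewrite ?inE // lt_neqAle zx.
by case: (rho z x).
Qed.

End TopDegree.

Lemma homog_coefs m (p : {poly int}) (e : {poly {poly int}}) : tdeg_lt m e ->
  \sum_(i < m.+1) ((homog m p + e)`_i`_(m - i))%:~R * varu ^+ i * varv ^+ (m - i) =
  homog m p.
Proof.
move=> de; apply: eq_bigr => i _; have im : (i <= m)%N by rewrite -ltnS.
by rewrite !coefD coef_homog subnKC // eqxx de ?subnKC // addr0.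
Qed.

(** Lifting along the identity forces the two rank functions to coincide. Then K = k, so H = bar (g
    k) = g and L = g g^-1 is the identity. *)
Lemma mixed_h_id (dB : Order.disp_t) (B : finPOrderType dB) (rG rB : B -> int) x y :
  locally_Eulerian [set: B] -> is_rank_function rB ->
  strong_formal_subdivision rG rB id -> (y <= x)%O ->
  mixed_h rG rB id x y = eval1 (gpoly (itv y x)) (varu * varv).
Proof.
move=> lB rkB strong yx.
have eqr : rG = rB.
  apply/funext => z; have [_ rle _ lift _] := strong.
  by have [z' [_ -> ]] := lift z z (lexx z).
rewrite {}eqr in strong *; have weak := strong_weak_subdivision strong.
have hE : hfun id = gfun :> (B -> B -> _).
  rewrite (hfun_bar rkB rkB weak) -[RHS](barK (graded_gfun lB rkB)) (bar_gfun lB rkB).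
  congr (bar _ _ (conv _ _)); apply: funext2 => i j; rewrite /mkernel /kernel.
  by case: ifP => // ij; rewrite (absz_rank rkB ij).
rewrite mixed_hE /lfun hE (conv_gfun_inv lB rkB) gform_delta conv_deltal.
by rewrite /gfun yx.
Qed.

(** Homogenization turns L_tau L_sigma into a convolution; associativity lets the factor for sigma
    absorb g(uv). *)
Lemma mixed_h_comp (dO dG dB : Order.disp_t) (O : finPOrderType dO)
    (G : finPOrderType dG) (B : finPOrderType dB)
    (rO : O -> int) (rG : G -> int) (rB : B -> int)
    (tau : O -> G) (sigma : G -> B) (z : O) (x : B) :
  locally_Eulerian [set: O] -> locally_Eulerian [set: G] -> locally_Eulerian [set: B] ->
  is_rank_function rO -> is_rank_function rG -> is_rank_function rB ->
  weak_subdivision rO rG tau -> weak_subdivision rG rB sigma ->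
  mixed_h rO rB (sigma \o tau) x z =
  \sum_(y : G) mixed_h rG rB sigma x y * homog `|rG y - rO z|%N (local_h tau y z).
Proof.
move=> lO lG lB rkO rkG rkB wt ws.
rewrite mixed_hE (lfun_comp lO lG rkO rkG rkB wt ws).
rewrite (gform_conv (graded_lfun lO lG rkO rkG wt) (graded_lfun lG lB rkG rkB ws)) -convA.
rewrite {1}/conv; apply: eq_bigr => y _; rewrite -mixed_hE mulrC local_hE //.
Qed.

Theorem theorem5p5 :
  (* (1)-(4), (6)-(8) *)
  (forall (dG dB : Order.disp_t) (G : finPOrderType dG) (B : finPOrderType dB)
     (rG : G -> int) (rB : B -> int) (sigma : G -> B) (r n : nat)
     (G0 : G) (B0 B1 : B),
     lower_Eulerian [set: G] -> Eulerian [set: B] ->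
     is_rank_function rG -> is_rank_function rB ->
     rk [set: G] = r -> rk [set: B] = n ->
     is_minimum [set: G] G0 -> is_minimum [set: B] B0 ->
     is_maximum [set: B] B1 ->
     strong_formal_subdivision rG rB sigma ->
     rB B0 - rG G0 = r%:Z - n%:Z ->
     let h := mixed_h rG rB sigma B1 G0 in
     let l := local_h sigma B1 G0 in
     (* (1) *)
     h = eval2 h varv varu /\
     (* (2) *)
     eval2 h 'X 1 = hpoly [set: G] /\
     (* (3) *)
     (forall (F : fieldType) (u v : F), u != 0 -> v != 0 ->
        (u * v) ^+ r * eval2 h u^-1 v^-1 =
        \sum_(x : B) eval2 (mixed_h rG rB sigma x G0) u v
                       * (u * v - 1) ^+ rho x B1) /\
     (* (4) *)
     eval2 h 0 'X = 'X^(r - n) :> {poly int} /\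
     (* (6) *)
     (n = 0%N -> h = homog r l /\ homog r l = homog r (hpoly [set: G])) /\
     (* (7) *)
     ((forall i j : nat, (r < i + j)%N -> h`_i`_j = 0) /\
      \sum_(i < r.+1) (h`_i`_(r - i))%:~R * varu ^+ i * varv ^+ (r - i) =
      homog r l) /\
     (* (8) *)
     homog r l =
       \sum_(x : B) mixed_h rG rB sigma x G0 * (-1) ^+ rho x B1
                      * eval1 (gpoly (dual_set (itv x B1))) (varu * varv))
  /\
  (* (5) *)
  (forall (dB : Order.disp_t) (B : finPOrderType dB) (rG rB : B -> int)
     (B0 B1 : B),
     Eulerian [set: B] -> is_rank_function rG -> is_rank_function rB ->
     is_minimum [set: B] B0 -> is_maximum [set: B] B1 ->
     strong_formal_subdivision rG rB id ->
     mixed_h rG rB id B1 B0 = eval1 (gpoly [set: B]) (varu * varv))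
  /\
  (* (9) *)
  (forall (dO dG dB : Order.disp_t) (O : finPOrderType dO)
     (G : finPOrderType dG) (B : finPOrderType dB)
     (rO : O -> int) (rG : G -> int) (rB : B -> int)
     (tau : O -> G) (sigma : G -> B),
     locally_Eulerian [set: O] -> locally_Eulerian [set: G] ->
     locally_Eulerian [set: B] ->
     is_rank_function rO -> is_rank_function rG -> is_rank_function rB ->
     strong_formal_subdivision rO rG tau ->
     strong_formal_subdivision rG rB sigma ->
     (forall (z : O) (x : B),
        mixed_h rO rB (sigma \o tau) x z =
        \sum_(y : G) mixed_h rG rB sigma x y
                       * homog `|rG y - rO z|%N (local_h tau y z)) /\
     (lower_Eulerian [set: O] -> lower_Eulerian [set: G] ->
      Eulerian [set: B] ->
      forall (O0 : O) (B1 : B),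
        is_minimum [set: O] O0 -> is_maximum [set: B] B1 ->
        mixed_h rO rB (sigma \o tau) B1 O0 =
        \sum_(y : G) mixed_h rG rB sigma B1 y
                       * homog (rk (fiber tau y)) (local_h tau y O0))).
Proof.
split; [|split].
- move=> dG dB G B rG rB sigma r n G0 B0 B1 [lG _] EB rkG rkB rG_ nB [_ minG] [_ minB].
  move=> [_ maxB] strong rank_s h l.
  have lB := locally_Eulerian_Eulerian EB.
  have weak := strong_weak_subdivision strong.
  have [homo_s rle surj _ _] := strong.
  (* By surjectivity B0 is the image of some y, and y lies above G0. *)
  have s0 : sigma G0 = B0.
    apply/eqP; rewrite eq_le minB ?inE // andbT.
    by have [y <-] := surj B0; apply: homo_s; apply: minG; rewrite inE.
  have B01 : (B0 <= B1)%O by apply: maxB; rewrite inE.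
  (* The whole of G is a fiber above G0, so its rank r is the rank difference between G0 and B1 and
     its h-polynomial is a value of H. *)
  have fT : fiber_above sigma G0 B1 = [set: G].
    by apply/setP => z; rewrite !inE minG ?inE // maxB ?inE.
  have rE : `|rB B1 - rG G0|%N = r.
    by rewrite -rG_ -fT (rk_fiber_above rkG rkB weak) // s0.
  have nE : rho B0 B1 = n.
    by rewrite -nB -rk_itv /itv (itv_in_min_max (a := B0) (b := B1)).
  have lE : l = lfun sigma G0 B1 by rewrite /l local_hE.
  have VE : homog r l = gform rG rB varu varv (lfun sigma) G0 B1.
    by rewrite /gform rE lE.
  have xB1 x : (x <= B1)%O by apply: maxB; rewrite inE.
  have [e de hE] := mixed_h_top lB rkB weak B1 G0.
  rewrite rE -lE -/h in hE de.
  split; [|split; [|split; [|split; [|split; [|split]]]]].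
  + by rewrite mixed_h_swap.
  + by rewrite mixed_h_v1 // /hfun s0 B01 fT.
  + move=> F u v u0 v0; rewrite -rE mixed_h_inv //.
    by apply: eq_bigl => x; rewrite xB1.
  + rewrite mixed_h_u0 ?s0 //; congr ('X^ _).
    (* The rank r - n of sigma is nonnegative as rG G0 <= rB B0, so the truncated subtraction is
       exact. *)
    by have := rle G0; rewrite s0; lia.
  (* Rank 0 makes B a single point, so each convolution has one term, with trivial g. *)
  + move=> n0; have all_B1 x : x = B1.
      apply/eqP; apply: contraT => xb; have xlt : (x < B1)%O by rewrite lt_neqAle xb xB1.
      by have := rk_gt0 (in_setT x) (in_setT B1) xlt; rewrite nB n0.
    have one (P : B -> {poly {poly int}}) : \sum_x P x = P B1.
      by rewrite (bigD1 B1) //= big1 ?addr0 // => x; rewrite (all_B1 x) eqxx.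
    split.
      by rewrite /h mixed_hE /conv one (gfun_refl lB) rmorph1 mulr1 VE.
    congr homog; rewrite lE /lfun /conv (bigD1 B1) //= big1 => [|x]; last first.
      by rewrite (all_B1 x) eqxx.
    by rewrite addr0 (gfun_inv_refl lB) mulr1 /hfun s0 B01 fT.
  + split; last by rewrite hE homog_coefs.
    move=> i j ij; rewrite hE !coefD coef_homog de ?addr0; last by apply: ltnW.
    by case: eqP => // eij; rewrite eij ltnn in ij.
  + rewrite VE (mixed_h_local_h rG sigma lB rkB).
    by apply: eq_bigl => x; rewrite xB1.
- move=> dB B rG rB B0 B1 EB rkG rkB minB maxB strong.
  have lB := locally_Eulerian_Eulerian EB.
  rewrite mixed_h_id //; last by case: minB => _; apply; rewrite inE.
  by rewrite /itv itv_in_min_max.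
move=> dO dG dB O G B rO rG rB tau sigma lO lG lB rkO rkG rkB st ss.
have wt := strong_weak_subdivision st; have ws := strong_weak_subdivision ss.
split=> [z x | _ _ _ O0 B1 [_ minO] _]; first exact: mixed_h_comp.
rewrite (mixed_h_comp O0 B1 lO lG lB rkO rkG rkB wt ws); apply: eq_bigr => y _.
(* The two homogenization degrees agree when tau O0 <= y; otherwise the local polynomial is zero and
   the degree is immaterial. *)
congr (_ * _); have [ty | nty] := boolP (tau O0 <= y)%O; last first.
  by rewrite local_hE lfun_supp // !homog0.
rewrite -(rk_fiber_above rkO rkG wt ty); congr (homog (rk _) _).
by apply/setP => z; rewrite !inE minO ?inE.
Qed.
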